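(* Let $(\mathcal{B},\mathcal{B}^* )$ be a two-dimensional MAP alternating Brownian motion driven by a MAP$(\boldsymbol{b},C,D)$ with finite phase space $\mathcal{S}$. Then for every $t>0$ the correlation coefficient function of $\mathcal{B}$ and $\mathcal{B}^*$ is given by $$\mathrm{Corr}(t)=\frac1t\begin{bmatrix}\boldsymbol{b}&\boldsymbol{0}&0\end{bmatrix}\exp\left(\begin{bmatrix}C&D&\boldsymbol{e}\\ D&C&-\boldsymbol{e}\\ 0&0&0\end{bmatrix}t\right)\begin{bmatrix}\boldsymbol{0}\\ \boldsymbol{0}\\ 1\end{bmatrix},$$ where $\boldsymbol{e}$ denotes the column vector of $1$s of size $|\mathcal{S}|$, $\boldsymbol{0}$ denotes zero vectors of size $|\mathcal{S}|$ (row or column as appropriate), and $\exp$ is the matrix exponential of a square matrix of size $2|\mathcal{S}|+1$.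
   Context: MAP: a continuous-time Markovian arrival process (MAP) of parameters $(\boldsymbol{b},C,D)$ with finite phase space $\mathcal{S}$ is a counting process $\mathcal{K}=\{K(t)\}_{t\ge0}$, $K(0)=0$, driven by an underlying Markov jump process on $\mathcal{S}$ with initial distribution $\boldsymbol{b}$ (a row vector) and intensity matrix $C+D$, where $D$ has nonnegative entries, $C$ has nonnegative off-diagonal entries, and $C+D$ has zero row sums. The counting process increases by one exactly at the epochs of jumps which occur due to the intensities of $D$: when the phase is $i$, a transition to $j\ne i$ without increase of $K$ occurs at rate $C_{ij}$, and a transition to $j$ (possibly $j=i$) with an increase of $K$ by $1$ occurs at rate $D_{ij}$. MAP alternating Brownian motion: let $\mathcal{K}$ be a continuous-time MAP$(\boldsymbol{b},C,D)$ and let $\mathcal{B}=\{B(t)\}_{t\ge0}$ be a standard Brownian motion independent of the MAP. Define $\mathcal{B}^*=\{B^*(t)\}_{t\ge0}$ by $B^*(t)=\int_0^t(-1)^{K(s)}\,\mathrm{d}B(s)$, $t\ge0$. The process $(\mathcal{B},\mathcal{B}^* )$ is called a two-dimensional MAP alternating Brownian motion. The correlation coefficient function is $$\mathrm{Corr}(t)=\frac{\mathbb{E}[B(t)B^*(t)]-\mathbb{E}[B(t)]\,\mathbb{E}[B^*(t)]}{\sqrt{\mathrm{Var}(B(t))}\sqrt{\mathrm{Var}(B^*(t))}},\qquad t>0.$$ *)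

(* Defs.v *)
From HB Require Import structures.
From mathcomp Require Import all_boot all_order all_algebra.
From mathcomp Require Import all_classical all_reals all_analysis.
Set Implicit Arguments.
Unset Strict Implicit.
Unset Printing Implicit Defensive.
Import Order.TTheory GRing.Theory Num.Theory.
Import numFieldNormedType.Exports.
Local Open Scope classical_set_scope.
Local Open Scope ring_scope.

Definition mexp (R : realType) (n : nat) (A : 'M[R]_n) : 'M[R]_n :=
  lim (series (fun k => (k`!%:R)^-1 *: A ^+ k) @ \oo).

Section Sigma_algebras.
Context {d : measure_display} {T : measurableType d} {R : realType}.

(* Information carried at time u by a real-valued process, resp. by a process
   with values in a countable discrete space (all subsets are measurable). *)
Definition real_info (X : R -> T -> R) (u : R) : set_system T :=
  preimage_set_system setT (X u) measurable.

Definition discrete_info (U : Type) (X : R -> T -> U) (u : R) : set_system T :=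
  preimage_set_system setT (X u) setT.

Definition sigma_upto (G : R -> set_system T) (t : R) : set_system T :=
  <<s \bigcup_(u in `[0, t]) G u >>.

Definition sigma_all (G : R -> set_system T) : set_system T :=
  <<s \bigcup_(u in `[0, +oo[) G u >>.

Definition independent_systems (P : probability T R) (F G : set_system T) :=
  forall A A', F A -> G A' -> P (A `&` A') = (P A * P A')%E.

End Sigma_algebras.

Section Processes.
Context {d : measure_display} {T : measurableType d} {R : realType}.
Context (P : probability T R).

(* Processes are indexed by R; only nonnegative times are relevant. *)

Definition standard_brownian_motion (B : R -> {RV P >-> R}) : Prop :=
  [/\ {ae P, forall w, B 0 w = 0},
      {ae P, forall w, {within `[0, +oo[, continuous (fun t : R => B t w)}},
      (forall s t : R, 0 <= s -> s < t -> forall A, measurable A ->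
         P [set w | A (B t w - B s w)] = normal_prob 0 (Num.sqrt (t - s)) A)
    & (forall s t : R, 0 <= s -> s <= t ->
         independent_systems P (sigma_upto (real_info B) s)
           (preimage_set_system setT (fun w => B t w - B s w) measurable))].

Definition MAP_parameters (n : nat) (b : 'rV[R]_n) (C D : 'M[R]_n) : Prop :=
  [/\ (forall i, 0 <= b 0 i) /\ \sum_i b 0 i = 1,
      (forall i j, 0 <= D i j),
      (forall i j, i != j -> 0 <= C i j)
    & (forall i, \sum_j (C + D) i j = 0)].

(* p h m i j is the probability that, over a time span of length h, a phase
   started in i ends in j while the counter increases by m. *)
Definition stochastic_kernel (n : nat) (p : R -> nat -> 'I_n -> 'I_n -> R) :=
  forall h : R, 0 <= h ->
    (forall m i j, 0 <= p h m i j) /\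
    (forall i, (\sum_(0 <= m <oo) (\sum_j p h m i j)%:E = 1)%E).

(* Since all the p h m i j sum to one over (m, j) and C + D has zero row sums,
   these rates also force any increase of the counter by two or more over a
   time span of length h to have probability o(h), and, after summing over m,
   the phase to have intensity matrix C + D. *)
Definition MAP_rates (n : nat) (C D : 'M[R]_n)
    (p : R -> nat -> 'I_n -> 'I_n -> R) : Prop :=
  forall i j,
    (p h 0%N i j - (i == j)%:R) / h @[h --> 0^'+] --> C i j /\
    p h 1%N i j / h @[h --> 0^'+] --> D i j.

Definition MAP_with_phase (n : nat) (b : 'rV[R]_n) (C D : 'M[R]_n)
    (J : R -> T -> 'I_n) (K : R -> T -> nat) : Prop :=
  let JK := fun u w => (J u w, K u w) in
  [/\ MAP_parameters b C D,
      (forall u : R, 0 <= u -> discrete_info JK u `<=` measurable),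
      [/\ (forall w, K 0 w = 0%N),
          (forall (s t : R) w, 0 <= s -> s <= t -> (K s w <= K t w)%N),
          (forall (t : R) w, 0 <= t -> \forall s \near t^'+, JK s w = JK t w),
          (forall (t : R) w, 0 < t -> exists i, \forall s \near t^'-, J s w = i)
        & (forall (t : R) w, 0 < t ->
             \forall s \near t^'-, (K t w <= (K s w).+1)%N)],
      (forall i, P [set w | J 0 w = i] = (b 0 i)%:E)
    & exists p, [/\ stochastic_kernel p, MAP_rates C D p
        & forall (s h : R) A i j m, 0 <= s -> 0 <= h ->
            sigma_upto (discrete_info JK) s A ->
            P (A `&` [set w | J s w = i]
                 `&` [set w | J (s + h) w = j /\ K (s + h) w = (K s w + m)%N])
            = (P (A `&` [set w | J s w = i]) * (p h m i j)%:E)%E]].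

Definition is_MAP (n : nat) (b : 'rV[R]_n) (C D : 'M[R]_n)
    (K : R -> T -> nat) : Prop :=
  exists J, MAP_with_phase b C D J K.

(* The simple process that equals coef i on ]time i, time i.+1], i < size. *)
Record simple_process := SimpleProcess {
  sp_size : nat;
  sp_time : nat -> R;
  sp_coef : nat -> T -> R }.

Definition adapted_simple (F : R -> set_system T) (t : R)
    (H : simple_process) : Prop :=
  [/\ sp_time H 0 = 0, sp_time H (sp_size H) = t,
      (forall i, (i < sp_size H)%N -> sp_time H i <= sp_time H i.+1)
    & (forall i, (i < sp_size H)%N ->
         preimage_set_system setT (sp_coef H i) measurable
           `<=` F (sp_time H i) /\
         exists M, forall w, `|sp_coef H i w| <= M)].

Definition sp_eval (H : simple_process) (s : R) (w : T) : R :=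
  \sum_(i < sp_size H)
    sp_coef H i w * \1_(`]sp_time H i, sp_time H i.+1]) s.

Definition sp_integral (B : R -> T -> R) (H : simple_process) (w : T) : R :=
  \sum_(i < sp_size H)
    sp_coef H i w * (B (sp_time H i.+1) w - B (sp_time H i) w).

(* Y is (a version of) the Ito integral of H against B over [0, t]: the L^2
   limit of the integrals of adapted simple processes converging to H in
   L^2(P x dt). *)
Definition is_ito_integral (F : R -> set_system T) (B : R -> T -> R)
    (H : R -> T -> R) (t : R) (Y : T -> R) : Prop :=
  exists Hn : nat -> simple_process,
    [/\ (forall k, adapted_simple F t (Hn k)),
        (\int[P]_w \int[lebesgue_measure]_(s in `[0%R, t])
           ((sp_eval (Hn k) s w - H s w) ^+ 2)%:E)%E @[k --> \oo] --> 0%E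
      & (\int[P]_w ((Y w - sp_integral B (Hn k) w) ^+ 2)%:E)%E @[k --> \oo]
          --> 0%E].

Definition MAP_alternating_BM (n : nat) (b : 'rV[R]_n) (C D : 'M[R]_n)
    (K : R -> T -> nat) (B Bstar : R -> {RV P >-> R}) : Prop :=
  [/\ is_MAP b C D K,
      standard_brownian_motion B,
      independent_systems P (sigma_all (real_info B))
        (sigma_all (discrete_info K))
    & forall t : R, 0 <= t ->
        is_ito_integral
          (sigma_upto (fun u => real_info B u `|` discrete_info K u))
          B (fun s w => (-1) ^+ K s w) t (Bstar t)].

(* [fine] is harmless for a MAP alternating Brownian motion: B t and Bstar t are
   then square integrable, so all these moments are finite. *)
Definition Corr (B Bstar : R -> {RV P >-> R}) (t : R) : R :=
  (fine 'E_P[B t \* Bstar t] - fine 'E_P[B t] * fine 'E_P[Bstar t])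
  / (Num.sqrt (fine 'V_P[B t]) * Num.sqrt (fine 'V_P[Bstar t])).

End Processes.

(* Main.v *)
Require Import Defs.
From HB Require Import structures.
From mathcomp Require Import all_boot all_order all_algebra.
From mathcomp Require Import all_classical all_reals all_analysis.
From mathcomp Require Import measurable_realfun.
From mathcomp Require Import ring lra.
Set Implicit Arguments.
Unset Strict Implicit.
Unset Printing Implicit Defensive.
Import Order.TTheory GRing.Theory Num.Theory.
Import numFieldNormedType.Exports.
Local Open Scope classical_set_scope.
Local Open Scope ring_scope.

(** Write X s = (-1) ^ K s. The formula says that the covariance of B t and
Bstar t is the integral of E (X s) over [0, t], and computes this integral.

The covariance. Since B is independent of the arrival process, an increment of
B after time s is independent of the joint past up to s
([increment_independent]). Hence the integrals of adapted simple processes H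
and G satisfy E [(int H dB) (int G dB)] = int E (H G) ds ([simple_isometry]).
Both sides are inner products, in L2(P) and in L2(P x ds), so the identity
passes to the L2 limits that define Bstar t ([ito_moments]): taking one factor
to be X and the other 1 gives cov (B t, Bstar t) = int_0^t E (X s) ds, and
taking both to be X gives Var (Bstar t) = t. As Var (B t) = t, Corr (t) is the
mean over [0, t] of E (X s).

The mean sign. Let v_j (s) be the expectation of X s on the event J s = j. Over
a short time h the counter stays put, at the rates of C, and the sign is kept,
or it increases by one, at the rates of D, and the sign is reversed; two or more
arrivals have probability o(h). Therefore v' = v (C - D), with v (0) = b
([mean_sign_phase_rderive]). The derivative of order k of E (X s) = v (s) e is
thus v (s) (C - D)^k e, which is O(a^k), and the Taylor series of
int_0^t E (X s) ds converges to it ([taylor_series_cvg]); its coefficient of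
order k + 1 is b (C - D)^k e.

The matrix exponential. The block matrix maps (0, 0, 1) to (e, -e, 0) and
(x, -x, 0) to ((C - D) x, - (C - D) x, 0), so the entry on the right-hand side
has the same series ([map_generator_expE], [mexp_sandwich]).

The rates are limits as h tends to 0 from the right, and they control the
increments of v uniformly in the starting time. Derivatives are accordingly
replaced by uniform right derivatives ([unif_rderive]), for which comparison and
Taylor estimates follow from telescoping over a grid. *)

(** * Uniform right derivatives *)

(** A right derivative whose error is uniform in the base point. The
uniformity does the work that continuity of f and a mean value theorem would do
for two-sided derivatives. *)
Definition unif_rderive (R : realType) (t : R) (f g : R -> R) :=
  forall e : R, 0 < e -> exists2 d : R, 0 < d & forall s h : R,
    0 <= s -> 0 < h -> h < d -> s + h <= t ->
    `|f (s + h) - f s - h * g s| <= e * h.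

Lemma unif_rderiveS (R : realType) (s t : R) (f g : R -> R) : s <= t ->
  unif_rderive t f g -> unif_rderive s f g.
Proof.
move=> st fg e /fg[d d0 H]; exists d => // x h x0 h0 hd xs.
by apply: H => //; exact: le_trans st.
Qed.

(** The hypothesis compares g with the increments of F, and f follows g up to
e * h on every cell of a fine grid of [0, t]; the errors add up to at most
e * t. *)
Lemma unif_rderive_le (R : realType) (t : R) (f g F : R -> R) : 0 <= t ->
  unif_rderive t f g ->
  (forall s h, 0 <= s -> 0 < h -> s + h <= t ->
     h * g s <= F (s + h) - F s) ->
  f t - f 0 <= F t - F 0.
Proof.
move=> t0 fg gF; apply/ler_addgt0Pr => e e0.
have e1 : 0 < e / (t + 1) by rewrite divr_gt0// ltr_wpDl.
have [d d0 fd] := fg _ e1.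
pose n := (Num.truncn (t / d)).+1.
have n0 : 0 < n%:R :> R by rewrite ltr0n.
have tn : t / n%:R < d.
  rewrite ltr_pdivrMr// mulrC -ltr_pdivrMr//; exact: truncnS_gt.
pose x i : R := i%:R * (t / n%:R).
have x0 i : 0 <= x i by rewrite mulr_ge0// divr_ge0// ltW.
have xS i : x i.+1 = x i + t / n%:R by rewrite /x -addn1 natrD mulrDl mul1r.
have xn : x n = t by rewrite /x mulrCA divff ?mulr1// gt_eqF.
have [{}t0|/eqP te0] := eqVneq t 0; first by rewrite t0 !subrr add0r ltW.
have tp : 0 < t by rewrite lt_neqAle eq_sym t0 andbT; apply/eqP.
have step i : (i <= n)%N -> f (x i) - f 0 <= F (x i) - F 0 + e / (t + 1) * x i.
  elim: i => [_|i IH lin]; first by rewrite /x mul0r !subrr mulr0 addr0.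
  have h0 : 0 < t / n%:R by rewrite divr_gt0.
  have xt : x i + t / n%:R <= t.
    by rewrite -xS -[leRHS]xn /x ler_wpM2r ?ler_nat// ltW.
  have := fd (x i) _ (x0 i) h0 tn xt; have := gF (x i) _ (x0 i) h0 xt.
  have := IH (ltnW lin); rewrite xS ler_norml => H1 H2 /andP[_ H3]; lra.
have := step n (leqnn n); rewrite xn => /le_trans; apply; rewrite lerD2l.
by rewrite -mulrA ler_piMr ?(ltW e0)// mulrC ler_pdivrMr ?mul1r ?lerDl ?ltr_wpDl.
Qed.

Lemma unif_rderiveD (R : realType) (t : R) (f f' g g' : R -> R) :
  unif_rderive t f g -> unif_rderive t f' g' ->
  unif_rderive t (fun s => f s + f' s) (fun s => g s + g' s).
Proof.
move=> fg fg' e e0; have e2 : 0 < e / 2 by rewrite divr_gt0.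
have [d d0 H] := fg _ e2; have [d' d'0 H'] := fg' _ e2.
exists (Num.min d d'); first by rewrite lt_min d0.
move=> s h s0 h0; rewrite lt_min => /andP[hd hd'] st.
rewrite (_ : _ - _ = (f (s + h) - f s - h * g s) +
  (f' (s + h) - f' s - h * g' s)); last by ring.
apply: (le_trans (ler_normD _ _)).
have := H s h s0 h0 hd st; have := H' s h s0 h0 hd' st; lra.
Qed.

Lemma unif_rderiveZ (R : realType) (t c : R) (f g : R -> R) :
  unif_rderive t f g ->
  unif_rderive t (fun s => c * f s) (fun s => c * g s).
Proof.
move=> fg e e0; have c1 : 0 < `|c| + 1 by rewrite ltr_wpDl.
have [|d d0 H] := fg (e / (`|c| + 1)); first by rewrite divr_gt0.
exists d => // s h s0 h0 hd st.
rewrite (_ : _ - _ = c * (f (s + h) - f s - h * g s)); last by ring.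
rewrite normrM; apply: (@le_trans _ _ ((`|c| + 1) * (e / (`|c| + 1) * h))).
  by apply: ler_pM => //; [rewrite lerDl|exact: H].
by rewrite mulrA mulrCA divff ?gt_eqF// mulr1.
Qed.

Lemma unif_rderive_sum (R : realType) (t : R) (I : Type) (r : seq I)
    (f g : I -> R -> R) : (forall k, unif_rderive t (f k) (g k)) ->
  unif_rderive t (fun s => \sum_(k <- r) f k s) (fun s => \sum_(k <- r) g k s).
Proof.
move=> fg; elim: r => [|k r IH].
  move=> e e0; exists 1 => // s h s0 h0 _ _.
  by rewrite !big_nil mulr0 !subrr normr0 mulr_ge0 ?ltW.
move=> e e0; have [d d0 H] := unif_rderiveD (fg k) IH e0.
by exists d => // s h s0 h0 hd st; rewrite !big_cons; exact: H.
Qed.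

Lemma unif_rderiveX (R : realType) (t : R) (k : nat) : 0 <= t ->
  unif_rderive t (fun s => s ^+ k) (fun s => k%:R * s ^+ k.-1).
Proof.
move=> t0.
(* the error is quadratic in h, with a factor that depends on k and t only *)
have [c c0 H] : exists2 c : R, 0 <= c & forall s h : R, 0 <= s -> 0 < h ->
    s + h <= t -> `|(s + h) ^+ k - s ^+ k - h * (k%:R * s ^+ k.-1)| <= c * h ^+ 2.
  elim: k => [|k [c c0 H]].
    by exists 0 => // s h _ _ _; rewrite !expr0 mul0r mulr0 !subrr normr0 mul0r.
  exists (t * c + k%:R * t ^+ k.-1).
    by rewrite addr_ge0// mulr_ge0// exprn_ge0.
  move=> s h s0 h0 st.
  rewrite [X in `|X|](_ : _ = (s + h) * ((s + h) ^+ k - s ^+ k - h * (k%:R * s ^+ k.-1))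
      + h ^+ 2 * (k%:R * s ^+ k.-1)); last first.
    by case: k {c c0 H} => [|k]; rewrite ?expr0 ?exprS -?natr1/=; ring.
  have st' : s <= t by lra.
  apply: (le_trans (ler_normD _ _)); rewrite [leRHS]mulrDl; apply: lerD.
    rewrite normrM -mulrA; apply: ler_pM => //; last exact: H.
    by rewrite ger0_norm// addr_ge0// ltW.
  rewrite ger0_norm; last by rewrite !mulr_ge0 ?exprn_ge0 ?(ltW h0).
  by rewrite mulrC ler_wpM2r ?exprn_ge0 ?(ltW h0)// ler_wpM2l// lerXn2r.
move=> e e0; exists (e / (c + 1)); first by rewrite divr_gt0// ltr_wpDl.
move=> s h s0 h0 he st; apply: (le_trans (H _ _ s0 h0 st)).
rewrite expr2 mulrA ler_wpM2r ?(ltW h0)//.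
apply: (@le_trans _ _ ((c + 1) * h)); first by rewrite ler_wpM2r ?lerDl// ltW.
by rewrite -ler_pdivlMl ?ltr_wpDl// mulrC ltW.
Qed.

(** The chords of a convex function are steeper than its tangent at their left
end. This makes
u ^+ k.+1 / k.+1`! usable as the F of [unif_rderive_le] when the derivative is
bounded by u ^+ k / k`!. *)
Lemma lerX_secant (R : realType) (k : nat) (s h : R) : 0 <= s -> 0 <= h ->
  k.+1%:R * (h * s ^+ k) <= (s + h) ^+ k.+1 - s ^+ k.+1.
Proof.
move=> s0 h0; elim: k => [|k IH]; first by rewrite !expr1 expr0; lra.
have : (s + h) * (k.+1%:R * (h * s ^+ k)) <= (s + h) * ((s + h) ^+ k.+1 - s ^+ k.+1).
  by rewrite ler_wpM2l// addr_ge0.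
have : 0 <= k.+1%:R * (h ^+ 2 * s ^+ k) by rewrite !mulr_ge0// ?exprn_ge0.
rewrite !(exprS _ k.+1) !(exprS s k) -(natr1 k.+1); nra.
Qed.

(** Induction on the order: the derivative of the remainder of order N + 1 is
the remainder of order N of the shifted family, so the bound for the latter is
integrated by comparison. *)
Lemma taylor_remainder (R : realType) (t a L : R) (f : nat -> R -> R) (N : nat) :
  0 <= t ->
  (forall k, unif_rderive t (f k) (f k.+1)) ->
  (forall k s, 0 <= s -> s <= t -> `|f k s| <= L * a ^+ k) ->
  forall s, 0 <= s -> s <= t ->
  `|f 0%N s - \sum_(k < N) f k 0 * (s ^+ k / k`!%:R)|
     <= L * a ^+ N * (s ^+ N / N`!%:R).
Proof.
move=> t0; elim: N f L => [|N IH] f L fS fL s s0 st.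
  by rewrite big_ord0 subr0 !expr0 fact0 divr1 !mulr1 -[L]mulr1 -(expr0 a) fL.
set c := L * a ^+ N.+1.
pose F u := f 0%N u - \sum_(k < N.+1) f k 0 * (u ^+ k / k`!%:R).
pose G u := f 1%N u - \sum_(k < N) f k.+1 0 * (u ^+ k / k`!%:R).
have Gc u : 0 <= u -> u <= t -> `|G u| <= c * (u ^+ N / N`!%:R).
  move=> u0 ut; rewrite /c exprS mulrA.
  apply: (IH (fun k => f k.+1) (L * a)) => // k x x0 xt.
  by rewrite -mulrA -exprS; exact: fL.
have FG : unif_rderive s F G.
  have fs : unif_rderive s (f 0%N) (f 1%N) := unif_rderiveS st (fS 0%N).
  have ps : unif_rderive s (fun u => \sum_(k < N.+1) - (f k 0 / k`!%:R) * u ^+ k)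
      (fun u => \sum_(k < N.+1) - (f k 0 / k`!%:R) * (k%:R * u ^+ k.-1)).
    apply: (@unif_rderive_sum _ s _ _ (fun (k : 'I_N.+1) u => - (f k 0 / k`!%:R) * u ^+ k)
      (fun (k : 'I_N.+1) u => - (f k 0 / k`!%:R) * (k%:R * u ^+ k.-1))) => k.
    exact/unif_rderiveZ/unif_rderiveX.
  move=> e e0; have [d d0 H] := unif_rderiveD fs ps e0; exists d => // x h x0 h0 hd xs.
  have := H _ _ x0 h0 hd xs.
  suff E1 u : F u = f 0%N u + \sum_(k < N.+1) - (f k 0 / k`!%:R) * u ^+ k.
    suff -> : G x = f 1%N x + \sum_(k < N.+1) - (f k 0 / k`!%:R) * (k%:R * x ^+ k.-1).
      by rewrite !E1.
    rewrite big_ord_recl/= mul0r mulr0 add0r /G -sumrN; congr (_ + _).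
    apply: eq_bigr => i _; rewrite /bump/= add1n factS natrM invfM.
    have i0 : (i`!%:R : R) != 0 by rewrite pnatr_eq0 -lt0n fact_gt0.
    have i1 : (i.+1%:R : R) != 0 by rewrite pnatr_eq0.
    rewrite add0n; move: i1; set p := (i.+1%:R : R) => i1.
    rewrite mulNr; congr (- _); rewrite -!mulrA; congr (_ * _).
    by rewrite [X in _ = _ * X]mulrCA mulKf// mulrC.
  by rewrite /F -sumrN; congr (_ + _); apply: eq_bigr => i _; ring.
have F0 : F 0 = 0.
  rewrite /F big_ord_recl/= expr0 fact0 divr1 mulr1 big1 ?addr0 ?subrr// => i _.
  by rewrite /bump/= add1n expr0n/= mul0r mulr0.
(* an upper bound for F, to be used for F and for - F *)
have key (F1 G1 : R -> R) : unif_rderive s F1 G1 -> F1 0 = 0 ->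
    (forall u, 0 <= u -> u <= t -> G1 u <= c * (u ^+ N / N`!%:R)) ->
    F1 s <= c * (s ^+ N.+1 / N.+1`!%:R).
  move=> FG1 F10 Gc1.
  have := @unif_rderive_le _ s F1 G1 (fun u => c * (u ^+ N.+1 / N.+1`!%:R)) s0 FG1.
  rewrite F10 subr0 expr0n/= mul0r mulr0 subr0; apply.
  move=> u h u0 h0 us.
  have ut : u <= t by lra.
  have c0 : 0 <= c by apply: le_trans (fL N.+1 0 _ _).
  apply: (@le_trans _ _ (h * (c * (u ^+ N / N`!%:R)))).
    by rewrite ler_wpM2l ?Gc1 ?(ltW h0).
  rewrite -mulrBr mulrCA ler_wpM2l// -mulrBl ler_pdivlMr ?ltr0n ?fact_gt0//.
  apply: le_trans (lerX_secant N u0 (ltW h0)).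
  rewrite factS natrM le_eqVlt; apply/orP; left; apply/eqP.
  have i0 : (N`!%:R : R) != 0 by rewrite pnatr_eq0 -lt0n fact_gt0.
  by field.
rewrite ler_norml; apply/andP; split; last first.
  by apply: key FG F0 _ => u u0 ut; apply: le_trans (Gc u u0 ut); rewrite ler_norm.
rewrite lerNl; apply: (key (fun u => - F u) (fun u => - G u)).
- move=> e e0; have [d d0 H] := unif_rderiveZ (-1) FG e0; exists d => // x h x0 h0 hd xs.
  by have := H _ _ x0 h0 hd xs; rewrite !mulN1r.
- by rewrite F0 oppr0.
- by move=> u u0 ut; apply: le_trans (Gc u u0 ut); rewrite -normrN ler_norm.
Qed.

(** The remainder is at most L times a term of the series of expR (a * t). *)
Lemma taylor_series_cvg (R : realType) (t a L : R) (f : nat -> R -> R) :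
  0 <= t ->
  (forall k, unif_rderive t (f k) (f k.+1)) ->
  (forall k s, 0 <= s -> s <= t -> `|f k s| <= L * a ^+ k) ->
  series (fun k => f k 0 * (t ^+ k / k`!%:R)) @ \oo --> f 0%N t.
Proof.
move=> t0 fS fL; apply/(@cvgrPdist_le _ R^o) => e e0.
have : L * (exp_coeff (a * t) n) @[n --> \oo] --> L * 0.
  by apply: cvgMr; exact: cvg_exp_coeff.
rewrite mulr0 => /(@cvgrPdist_le _ R^o)/(_ _ e0); apply: filterS => N.
rewrite sub0r normrN => /(le_trans _); apply.
rewrite /series/= big_mkord; apply: le_trans (taylor_remainder N t0 fS fL t0 _) _ => //.
by rewrite -mulrA mulrA mulrA -(mulrA L) -exprMn -mulrA ler_norm.
Qed.

Lemma integrable_cstr d (T : measurableType d) (R : realType)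
    (mu : {measure set T -> \bar R}) (A : set T) (c : R) :
  measurable A -> (mu A < +oo)%E -> mu.-integrable A (EFin \o cst c).
Proof.
move=> mA muA; apply/integrableP; split; first exact/measurable_EFinP.
rewrite [X in (X < _)%E](_ : _ = (\int[mu]_(x in A) cst `|c|%:E x)%E)//.
by rewrite integral_cst// lte_mul_pinfty.
Qed.

(** Over a short span h, f varies by at most (L + 1) * h whatever the base
point, so its integral over ]s, s + h] is h * f s up to (L + 1) * h ^+ 2. *)
Lemma integral_unif_rderive (R : realType) (t L : R) (f g : R -> R) :
  unif_rderive t f g -> (forall s, 0 <= s -> s <= t -> `|g s| <= L) ->
  lebesgue_measure.-integrable `[0, t] (EFin \o f) ->
  unif_rderive t (fun u => \int[lebesgue_measure]_(s in `[0, u]) f s) f.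
Proof.
move=> fg gL fi e e0; have [d d0 H] := fg 1 ltr01.
have [t0|t0] := ltP t 0; first by exists 1 => // s h s0 h0 _ ?; lra.
have L0 : 0 <= L by apply: le_trans (gL 0 _ _).
exists (Num.min d (e / (L + 1))); first by rewrite lt_min d0 divr_gt0// ltr_wpDl.
move=> s h s0 h0; rewrite lt_min => /andP[hd he] st.
have fsh : lebesgue_measure.-integrable `[0, s + h] (EFin \o f).
  by apply: integrableS fi => //; apply: subset_itvl; rewrite bnd_simp.
have fs : lebesgue_measure.-integrable `]s, s + h] (EFin \o f).
  by apply: integrableS fi => //; apply: subset_itv; rewrite bnd_simp.
have -> : \int[lebesgue_measure]_(x in `[0, s + h]) f x -
    \int[lebesgue_measure]_(x in `[0, s]) f x =
    \int[lebesgue_measure]_(x in `]s, s + h]) f x.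
  by rewrite Rintegral_itvB// bnd_simp// lerDl ltW.
have mE : lebesgue_measure (`]s, s + h] : set (measurableTypeR R))%classic = h%:E.
  by rewrite lebesgue_measure_itv/= lte_fin ltrDl h0 -EFinB; congr EFin; ring.
have ci (c : R) : lebesgue_measure.-integrable `]s, s + h] (EFin \o cst c).
  by apply: integrable_cstr => //; rewrite [X in (X < _)%E]mE ltry.
have ic (c : R) : \int[lebesgue_measure]_(x in `]s, s + h]) cst c x = c * h.
  by rewrite Rintegral_cst//; congr (_ * _); exact: (congr1 fine mE).
have -> : h * f s = \int[lebesgue_measure]_(x in `]s, s + h]) cst (f s) x.
  by rewrite ic mulrC.
rewrite -RintegralB//.
have -> : e * h = \int[lebesgue_measure]_(x in `]s, s + h]) cst e x.
  by rewrite ic.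
have ifB : lebesgue_measure.-integrable `]s, s + h] (EFin \o (fun x => f x - cst (f s) x)).
  exact: (integrableB _ fs (ci _)).
apply: (le_trans (le_normr_Rintegral _ ifB)) => //.
apply: le_Rintegral => //; first exact: (integrable_norm ifB).
move=> x; rewrite /= in_itv/= => /andP[sx xh].
have xs : 0 < x - s by rewrite subr_gt0.
have xd : x - s < d by lra.
have xt : s + (x - s) <= t by lra.
have := H s (x - s) s0 xs xd xt; rewrite subrKC mul1r => hx.
have gs := gL s s0 (le_trans (ltW sx) (le_trans xh st)).
have xshe : (x - s) * (L + 1) <= e.
  rewrite -ler_pdivlMr ?ltr_wpDl//; lra.
apply: le_trans xshe.
have : `|f x - f s| <= `|f x - f s - (x - s) * g s| + `|(x - s) * g s|.
  by rewrite -[X in `|X| <= _](subrK ((x - s) * g s)) ler_normD.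
rewrite normrM (gtr0_norm xs) => /le_trans; apply.
by have := ler_wpM2l (ltW xs) gs; lra.
Qed.

(** * The matrix exponential of the alternating generator *)

(** The absolute sum of a row is at most that of all the entries; the added 1
makes the base at least 1, which covers the identity matrix at k = 0 and keeps
the bound monotone in k. *)
Lemma normr_mx_exp_le (R : realType) (n : nat) (A : 'M[R]_n) (k : nat) i j :
  `|(A ^+ k) i j| <= (1 + \sum_i \sum_j `|A i j|) ^+ k.
Proof.
set a := 1 + _; elim: k i j => [|k IH] i j.
  by rewrite !expr0 mxE; case: eqP; rewrite ?normr1 ?normr0.
have a0 : 0 <= a by rewrite addr_ge0// sumr_ge0// => *; rewrite sumr_ge0.
rewrite !exprS mxE; apply: (le_trans (ler_norm_sum _ _ _)).
apply: (@le_trans _ _ (\sum_l `|A i l| * a ^+ k)).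
  by apply: ler_sum => l _; rewrite normrM ler_wpM2l.
rewrite -mulr_suml ler_wpM2r ?exprn_ge0// /a [X in _ <= _ + X](bigD1 i)//=.
rewrite addrCA lerDl.
by rewrite addr_ge0// sumr_ge0// => *; rewrite sumr_ge0.
Qed.

Lemma is_cvg_mexp_entry (R : realType) (n : nat) (A : 'M[R]_n) i j :
  cvgn (series (fun k => (A ^+ k) i j / k`!%:R)).
Proof.
set a := 1 + \sum_i \sum_j `|A i j|.
apply: normed_cvg; apply: (series_le_cvg _ _ _ (is_cvg_series_exp_coeff a)) => //.
- by move=> k /=.
- move=> k; rewrite /exp_coeff/= divr_ge0// exprn_ge0// addr_ge0// sumr_ge0//.
  by move=> *; rewrite sumr_ge0.
- move=> k; rewrite /exp_coeff/= normrM [X in _ * X]ger0_norm ?invr_ge0//.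
  by rewrite ler_wpM2r ?invr_ge0// normr_mx_exp_le.
Qed.

(** Each entry of the series is dominated by the exponential series of a real
number, and convergence of matrices is convergence of the finitely many
entries. *)
Lemma cvg_mexp (R : realType) (n : nat) (A : 'M[R]_n) :
  series (fun k => (k`!%:R)^-1 *: A ^+ k) @ \oo --> mexp A.
Proof.
suff : cvgn (series (fun k => (k`!%:R)^-1 *: A ^+ k)) by [].
apply/cvg_ex; exists (\matrix_(i, j) limn (series (fun k => (A ^+ k) i j / k`!%:R))).
apply/cvg_ballP => e e0.
have : \forall N \near \oo, forall ij : 'I_n * 'I_n,
    ball (limn (series (fun k => (A ^+ k) ij.1 ij.2 / k`!%:R))) e
      (series (fun k => (A ^+ k) ij.1 ij.2 / k`!%:R) N).
  apply: filter_forall => -[i j]; move: e e0; apply/cvg_ballP.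
  exact: is_cvg_mexp_entry.
apply: filterS => N H; split => // i j; rewrite mxE; have := H (i, j).
rewrite /series/= summxE; congr ball.
by apply: eq_bigr => k _; rewrite mxE mulrC.
Qed.

Lemma cvg_sumr (R : realType) (T I : Type) (F : set_system T) (r : seq I)
    (f : I -> T -> R) (a : I -> R) : Filter F ->
  (forall i, true -> f i x @[x --> F] --> a i) ->
  \sum_(i <- r) f i x @[x --> F] --> \sum_(i <- r) a i.
Proof. by move=> FF fa; apply: cvg_big => //; exact: add_continuous. Qed.

(** M |-> u *m M *m c is continuous, so an entry of the exponential can be
computed from a series of scalars. *)
Lemma mexp_sandwich (R : realType) (n : nat) (u : 'rV[R]_n) (A : 'M[R]_n)
    (c : 'cV[R]_n) (l : R) :
  series (fun k => (u *m A ^+ k *m c) 0 0 / k`!%:R) @ \oo --> l ->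
  (u *m mexp A *m c) 0 0 = l.
Proof.
move=> ul; apply: (@cvg_unique R _ (series (fun k => (u *m A ^+ k *m c) 0 0 / k`!%:R) @ \oo)) => //.
have E (M : 'M[R]_n) : (u *m M *m c) 0 0 = \sum_j \sum_i u 0 i * M i j * c j 0.
  by rewrite mxE; apply: eq_bigr => j _; rewrite mxE mulr_suml.
have -> : series (fun k => (u *m A ^+ k *m c) 0 0 / k`!%:R) =
    (fun N => \sum_j \sum_i u 0 i *
      (series (fun k => (k`!%:R)^-1 *: A ^+ k) N : 'M[R]_n) i j * c j 0).
  apply/funext => N; rewrite -E /series/= mulmx_sumr mulmx_suml summxE.
  by apply: eq_bigr => k _; rewrite -scalemxAr -scalemxAl [RHS]mxE mulrC.
rewrite E.
apply: cvg_sumr => j _; apply: cvg_sumr => i _; apply: cvgMl; apply: cvgMr.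
apply: (@cvg_comp _ _ _ (series (fun k => (k`!%:R)^-1 *: A ^+ k))
  (fun M : 'M[R]_n => M i j) _ (nbhs (mexp A))); first exact: cvg_mexp.
exact: coord_continuous.
Qed.

(** The generator maps (0, 0, 1) to (e, -e, 0) and acts as C - D on the vectors
(x, -x, 0); the two phase blocks carry opposite signs because an arrival swaps
them. *)
Lemma map_generator_expE (R : realType) (n : nat) (b : 'rV[R]_n)
    (C D : 'M[R]_n) (t : R) (k : nat) :
  ((row_mx (row_mx b 0) 0 : 'rV[R]_(n + n + 1)) *m
     (t *: block_mx (block_mx C D D C)
                         (col_mx (const_mx 1) (const_mx (-1)))
                         0 0 : 'M[R]_(n + n + 1)) ^+ k *m
     (col_mx (col_mx 0 0) 1 : 'cV[R]_(n + n + 1))) 0 0 =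
  if k is k'.+1 then
    t ^+ k * (b *m (C - D) ^+ k' *m (const_mx 1 : 'cV_n)) 0 0 else 0.
Proof.
set M := block_mx _ _ _ _.
case: k => [|k].
  rewrite expr0 mulmx1 !(mul_row_col) !mulmx0 mul0mx !addr0 mxE//.
rewrite -mulmxA.
have -> : (t *: M) ^+ k.+1 = t ^+ k.+1 *: M ^+ k.+1.
  elim: k.+1 => [|m IH]; first by rewrite !expr0 scale1r.
  by rewrite !exprS IH -mulmxE -scalemxAl -scalemxAr scalerA.
have H : M ^+ k.+1 *m (col_mx (col_mx 0 0) 1 : 'cV[R]_(n + n + 1)) =
   col_mx (col_mx ((C - D) ^+ k *m const_mx 1) (- ((C - D) ^+ k *m const_mx 1))) 0.
  elim: k => [|k IH].
    rewrite expr1 expr0 mul1mx /M mul_block_col !mulmx1 mul0mx !addr0.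
    rewrite col_mx0 mulmx0 add0r; congr (col_mx (col_mx _ _) _).
    by apply/matrixP => i j; rewrite !mxE.
  rewrite exprS -mulmxA IH /M mul_block_col mul_block_col mulmx0 !mul0mx !addr0.
  congr (col_mx (col_mx _ _) _); rewrite exprS -mulmxA mulmxBl mulmxN//.
  by rewrite opprB addrC.
rewrite -scalemxAl H -scalemxAr !mul_row_col !mul0mx !addr0 mxE.
by rewrite mulmxA.
Qed.

(** * First two moments of a centred normal variable *)

Section density.
Context d (X : measurableType d) (R : realType).
Variables (mu nu : {measure set X -> \bar R}) (p : X -> R).
Hypotheses (mp : measurable_fun setT p) (p0 : forall x, 0 <= p x)
  (nuE : forall A, measurable A -> nu A = (\int[mu]_(x in A) (p x)%:E)%E).
Import HBNNSimple.

Lemma integral_density_nnsfun (f : {nnsfun X >-> R}) :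
  (\int[nu]_x (f x)%:E = \int[mu]_x (f x * p x)%:E)%E.
Proof.
under [LHS]eq_integral do rewrite fimfunE -fsumEFin//.
rewrite [LHS]ge0_integral_fsum//; last 2 first.
  - by move=> r; exact/measurable_EFinP/measurableT_comp.
  - by move=> n x _; rewrite EFinM nnfun_muleindic_ge0.
under [RHS]eq_integral.
  move=> x xD; rewrite fimfunE EFinM -fsumEFin// ge0_mule_fsuml; last first.
    by move=> r; rewrite EFinM nnfun_muleindic_ge0.
  over.
have mpE : measurable_fun setT (EFin \o p) by exact/measurable_EFinP.
rewrite [RHS]ge0_integral_fsum//; last 2 first.
  - by move=> r; apply: emeasurable_funM => //; apply/measurable_EFinP/measurableT_comp.
  - move=> n x _; rewrite mule_ge0// ?lee_fin//.
    by rewrite -lee_fin EFinM nnfun_muleindic_ge0.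
apply: eq_fsbigr => r _.
rewrite integralZl_indic_nnsfun// integral_indic//= setIT nuE//.
have [r0|r0] := ltP r 0.
  rewrite preimage_nnfun0// integral_set0 mule0 integral0_eq// => x _.
  by rewrite indic0 mulr0 mul0e.
under [RHS]eq_integral do rewrite EFinM -muleA.
have mi : measurable_fun setT (fun x => (\1_(f @^-1` [set r]) x)%:E * (p x)%:E)%E.
  by apply: emeasurable_funM => //; apply/measurable_EFinP/measurable_indic.
rewrite ge0_integralZl//; last by move=> x _; rewrite mule_ge0// lee_fin.
congr (_ * _)%E; rewrite integral_mkcond; apply: eq_integral => x _.
by rewrite patchE indicE; case: ifPn => _; rewrite ?mul1e ?mul0e.
Qed.

(** Monotone convergence from simple functions. *)
Lemma ge0_integral_density (f : X -> R) :
  measurable_fun setT f -> (forall x, 0 <= f x) ->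
  (\int[nu]_x (f x)%:E = \int[mu]_x (f x * p x)%:E)%E.
Proof.
move=> mf f0.
have mfE : measurable_fun setT (EFin \o f) by exact/measurable_EFinP.
pose f_ := nnsfun_approx measurableT mfE.
have f_f x : (f_ n x)%:E @[n --> \oo] --> (f x)%:E.
  by apply: cvg_nnsfun_approx => //= y _; rewrite lee_fin.
have ndf x : {homo (fun n => f_ n x) : m n / (m <= n)%N >-> m <= n}.
  by move=> m n mn; apply/lefP/nd_nnsfun_approx.
transitivity (limn (fun n => \int[nu]_x (f_ n x)%:E)%E).
  rewrite -monotone_convergence//=.
  - by apply: eq_integral => x _; apply/esym/cvg_lim => //; exact: f_f.
  - by move=> n; exact/measurable_EFinP/measurable_funTS.
  - by move=> n x _; rewrite lee_fin.
  - by move=> x _ m n mn; rewrite lee_fin ndf.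
transitivity (limn (fun n => \int[mu]_x (f_ n x * p x)%:E)%E).
  by apply: congr_lim; apply/funext => n; exact: integral_density_nnsfun.
rewrite -monotone_convergence//=.
- apply: eq_integral => x _; apply/cvg_lim => //=.
  under eq_fun do rewrite EFinM.
  rewrite EFinM; apply: cvgeMr => //; exact: f_f.
- by move=> n; apply/measurable_EFinP/measurable_funM.
- by move=> n x _; rewrite lee_fin mulr_ge0.
- by move=> x _ m n mn; rewrite lee_fin ler_wpM2r// ndf.
Qed.

Lemma integral_density (f : X -> R) : measurable_fun setT f ->
  mu.-integrable setT (fun x => (f x * p x)%:E) ->
  nu.-integrable setT (EFin \o f) /\
  (\int[nu]_x (f x)%:E = \int[mu]_x (f x * p x)%:E)%E.
Proof.
move=> mf imf.
have mfE : measurable_fun setT (EFin \o f) by exact/measurable_EFinP.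
split.
  apply/integrableP; split => //; rewrite /= (@ge0_integral_density (fun x => `|f x|))//.
    case/integrableP : imf => _; apply: le_lt_trans; rewrite le_eqVlt; apply/orP; left.
    apply/eqP; apply: eq_integral => x _ /=.
    by rewrite normrM (ger0_norm (p0 x)).
  exact: measurableT_comp.
have mM (g : X -> R) : measurable_fun setT g ->
    measurable_fun setT (fun x => Num.max (g x) 0).
  by move=> mg; exact: measurable_funrpos.
have M0 (g : X -> R) x : 0 <= Num.max (g x) 0 by rewrite le_max lexx orbT.
rewrite integralE [RHS]integralE; congr (_ - _)%E.
  transitivity (\int[nu]_x (Num.max (f x) 0)%:E)%E.
    by apply: eq_integral => x _; rewrite funeposE EFin_max.
  rewrite ge0_integral_density//; last exact: mM.
  by apply: eq_integral => x _; rewrite funeposE -EFin_max maxr_pMl// mul0r.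
transitivity (\int[nu]_x (Num.max (- f x) 0)%:E)%E.
  by apply: eq_integral => x _; rewrite funenegE -EFinN EFin_max.
rewrite ge0_integral_density; last 2 first.
- by apply: (mM (fun x => - f x)); exact: measurableT_comp.
- by move=> x; exact: (M0 (fun x => - f x)).
by apply: eq_integral => x _; rewrite funenegE -EFinN -EFin_max maxr_pMl// mul0r mulNr.
Qed.
End density.

Section gauss_moments.
Context {R : realType} (s : R).
Hypothesis s0 : 0 < s.
Notation mu := (@lebesgue_measure R).
Let gauss := normal_fun 0 s.
(** [xgauss] is a primitive of [dxgauss] which vanishes at 0 and at infinity.
The integral of [dxgauss] over the half-line is therefore 0, that is, the second
moment of the Gaussian is s ^+ 2 times its mass. *)
Let xgauss (y : R) : R := - s ^+ 2 * y * gauss y.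
Let dxgauss (x : R) : R := (x ^+ 2 - s ^+ 2) * gauss x.

Lemma gaussE x : gauss x = expR (- x ^+ 2 / (s ^+ 2 *+ 2)).
Proof. by rewrite /gauss /normal_fun subr0. Qed.

Lemma gauss_even x : gauss (- x) = gauss x.
Proof. by rewrite !gaussE sqrrN. Qed.

Lemma is_derive_gauss (x : R) : is_derive x 1 gauss (- x / s ^+ 2 * gauss x).
Proof.
have -> : gauss = expR \o (fun y : R => (- (s ^+ 2 *+ 2)^-1) * y ^+ 2).
  by apply/funext => y /=; rewrite gaussE; congr expR; ring.
apply: is_derive_eq => /=; rewrite -?[_ *: _]/(_ * _).
have s1 : s != 0 by rewrite gt_eqF.
by rewrite -mulr_natr; field.
Qed.

Lemma is_derive_xgauss (x : R) :
  is_derive x 1 xgauss (dxgauss x).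
Proof.
rewrite /xgauss /dxgauss.
have := is_derive_gauss x => Dg.
apply: is_derive_eq; rewrite -![_ *: _]/(_ * _).
have s1 : s != 0 by rewrite gt_eqF.
by field.
Qed.

Lemma continuous_gauss : continuous gauss.
Proof.
by move=> x; apply/differentiable_continuous/derivable1_diffP; have [] := is_derive_gauss x.
Qed.

Lemma xgauss_cvg0 : xgauss y @[y --> +oo] --> 0.
Proof.
rewrite /xgauss.
rewrite -[0]oppr0; under eq_fun do rewrite !mulNr; apply: cvgN.
apply: (@squeeze_cvgr _ _ _ _ (cst 0) (fun y : R => s ^+ 2 * (s ^+ 2 *+ 2) / y)).
- near=> y; have y0 : 0 < y by near: y; exact: nbhs_pinfty_gt.
  rewrite /cst mulr_ge0 ?mulr_ge0 ?sqr_ge0 ?(ltW y0) ?(ltW s0) ?expR_ge0//=.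
  rewrite gaussE mulNr expRN.
  have : 0 < s ^+ 2 by rewrite exprn_gt0.
  move: (s ^+ 2) => c c0; have s2 : 0 < c *+ 2 by rewrite pmulrn_lgt0.
  rewrite -2!mulrA ler_pM2l// ler_pdivlMr//.
  rewrite mulrAC ler_pdivrMr ?expR_gt0//.
  have := expR_ge1Dx (y ^+ 2 / (c *+ 2)).
  rewrite -(ler_pM2l s2); apply: le_trans.
  by rewrite mulrDr mulrCA divff ?gt_eqF// !mulr1 -expr2 lerDr ltW.
- exact: cvg_cst.
- rewrite -[X in _ --> X](mulr0 (s ^+ 2 * (s ^+ 2 *+ 2))).
  apply: cvgMr; apply/(@gtr0_cvgV0 _ _ _ _ id); last exact: cvg_id.
  exact: nbhs_pinfty_gt.
Unshelve. all: by end_near. Qed.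

Lemma continuous_dxgauss : continuous dxgauss.
Proof.
move=> x; apply: cvgM; last exact: continuous_gauss.
by apply: cvgB; [exact: exprn_continuous|exact: cvg_cst].
Qed.

Lemma continuous_xgauss : continuous xgauss.
Proof.
by move=> x; apply/differentiable_continuous/derivable1_diffP; have [] := is_derive_xgauss x.
Qed.

Lemma derive1_xgauss x : derive1 xgauss x = dxgauss x.
Proof. by rewrite derive1E; have [_ ->] := is_derive_xgauss x. Qed.

Lemma xgauss0 : xgauss 0 = 0.
Proof. by rewrite /xgauss mulr0 mul0r. Qed.

(** The half-line is cut at s, where [dxgauss] changes sign: the fundamental
theorem of calculus on an unbounded interval is for nonnegative integrands. *)
Lemma integral_dxgauss_tail : (\int[mu]_(x in `[s, +oo[) (dxgauss x)%:E = 0%:E - (xgauss s)%:E)%E.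
Proof.
apply: ge0_continuous_FTC2y.
- move=> x sx; rewrite mulr_ge0 ?expR_ge0// subr_ge0 lerXn2r// nnegrE ?(ltW s0)//.
  exact: le_trans (ltW s0) sx.
- exact: (continuous_subspaceT continuous_dxgauss).
- exact: xgauss_cvg0.
- by move=> x _; have [] := is_derive_xgauss x.
- exact/cvg_at_right_filter/continuous_xgauss.
- by move=> x _; exact: derive1_xgauss.
Qed.

Lemma integral_dxgauss_head : (\int[mu]_(x in `[0%R, s]) (dxgauss x)%:E = (xgauss s)%:E - (xgauss 0)%:E)%E.
Proof.
apply: continuous_FTC2 => //.
- exact: (continuous_subspaceT continuous_dxgauss).
- split.
  + by move=> x _; have [] := is_derive_xgauss x.
  + exact/cvg_at_right_filter/continuous_xgauss.
  + exact/cvg_at_left_filter/continuous_xgauss.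
- by move=> x _; exact: derive1_xgauss.
Qed.

Lemma measurable_dxgauss : measurable_fun setT dxgauss.
Proof. exact: (continuous_measurable_fun continuous_dxgauss). Qed.

Lemma integrable_dxgauss_tail : mu.-integrable `[s, +oo[ (EFin \o dxgauss).
Proof.
apply/integrableP; split; first by apply/measurable_EFinP; exact: (measurable_funTS measurable_dxgauss).
rewrite (_ : (\int[mu]_(x in _) _)%E = (\int[mu]_(x in `[s, +oo[) (dxgauss x)%:E)%E).
  by rewrite integral_dxgauss_tail -EFinB ltry.
apply: eq_integral => x; rewrite inE/= in_itv/= andbT => sx.
rewrite ger0_norm// mulr_ge0 ?expR_ge0// subr_ge0 lerXn2r// nnegrE ?(ltW s0)//.
exact: le_trans (ltW s0) sx.
Qed.

Lemma integrable_dxgauss_head : mu.-integrable `[0%R, s] (EFin \o dxgauss).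
Proof.
apply: continuous_compact_integrable; first exact: segment_compact.
exact: (continuous_subspaceT continuous_dxgauss).
Qed.

Lemma halfline_split : `[0%R, +oo[%classic = `[0%R, s]%classic `|` `]s, +oo[%classic :> set R.
Proof. by rewrite -itv_bndbnd_setU// bnd_simp ltW. Qed.

Lemma integrable_dxgauss : mu.-integrable `[0%R, +oo[ (EFin \o dxgauss).
Proof.
have mE (D : set R) : measurable_fun D (EFin \o dxgauss).
  by apply/measurable_EFinP; exact: (measurable_funTS measurable_dxgauss).
apply/integrableP; split; first exact: mE.
rewrite halfline_split ge0_integral_setU//=; last 2 first.
- by rewrite -halfline_split; apply/measurable_EFinP/measurableT_comp => //; exact: (measurable_funTS measurable_dxgauss).
- by apply/disj_setPS => x [/=]; rewrite !in_itv/= andbT => /andP[_]; lra.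
rewrite lte_add_pinfty//; first by case/integrableP : integrable_dxgauss_head.
apply: le_lt_trans (proj2 (integrableP _ _ _ integrable_dxgauss_tail)).
apply: ge0_subset_integral => //=.
  by apply/measurable_EFinP/measurableT_comp => //; exact: (measurable_funTS measurable_dxgauss).
by move=> x; rewrite /= !in_itv/= !andbT => /ltW.
Qed.

Lemma integral_dxgauss : (\int[mu]_(x in `[0%R, +oo[) (dxgauss x)%:E = 0)%E.
Proof.
rewrite halfline_split integral_setU//=; last 2 first.
- by apply/measurable_EFinP; exact: (measurable_funTS measurable_dxgauss).
- by apply/disj_setPS => x [/=]; rewrite !in_itv/= andbT => /andP[_]; lra.
rewrite integral_itv_obnd_cbnd; last by apply/measurable_EFinP; exact: (measurable_funTS measurable_dxgauss).
by rewrite integral_dxgauss_tail integral_dxgauss_head -EFinB -EFinD xgauss0; congr EFin; ring.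
Qed.

Lemma integrable_gauss : mu.-integrable setT (EFin \o gauss).
Proof.
have s1 : s != 0 by rewrite gt_eqF.
have := integrable_normal_pdf 0 s => /(integrableZl measurableT (normal_peak s)^-1).
apply: eq_integrable => // x _ /=.
by rewrite normal_pdfE// -EFinM mulKf// gt_eqF// normal_peak_gt0.
Qed.

Lemma gauss_ge0 x : 0 <= gauss x.
Proof. exact: expR_ge0. Qed.

Lemma measurable_gauss : measurable_fun setT gauss.
Proof. exact: (continuous_measurable_fun continuous_gauss). Qed.

Lemma integral_gaussX2 : (\int[mu]_x (x ^+ 2 * gauss x)%:E = (s ^+ 2)%:E * \int[mu]_x (gauss x)%:E)%E.
Proof.
have ci0 : [set x : R | 0 <= x] = `[0%R, +oo[%classic by rewrite set_itvcy.
rewrite (@ge0_symfun_integralT _ (fun x => x ^+ 2 * gauss x))//; last 3 first.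
- by move=> x; rewrite mulr_ge0// ?sqr_ge0// gauss_ge0.
- by move=> x; apply: cvgM; [exact: exprn_continuous|exact: continuous_gauss].
- by move=> x /=; rewrite sqrrN gauss_even.
rewrite (@ge0_symfun_integralT _ gauss)//; [|exact: gauss_ge0|exact: continuous_gauss|].
2: by move=> x /=; rewrite gauss_even.
rewrite muleCA; congr (_ * _)%E; rewrite ci0.
have ig : mu.-integrable `[0%R, +oo[ (fun x => (s ^+ 2)%:E * (gauss x)%:E)%E.
  by apply: integrableZl => //; apply: integrableS integrable_gauss.
transitivity (\int[mu]_(x in `[0%R, +oo[) ((dxgauss x)%:E + (s ^+ 2)%:E * (gauss x)%:E))%E.
  by apply: eq_integral => x _; rewrite -EFinM -EFinD; congr EFin; rewrite /dxgauss; ring.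
rewrite (integralD _ integrable_dxgauss ig)// integral_dxgauss add0e.
rewrite ge0_integralZl//.
- by apply/measurable_EFinP; exact: (measurable_funTS measurable_gauss).
- by move=> x _; rewrite lee_fin gauss_ge0.
- by rewrite lee_fin sqr_ge0.
Qed.

Lemma integrable_gaussX2 : mu.-integrable setT (fun x => (x ^+ 2 * gauss x)%:E).
Proof.
apply/integrableP; split.
  by apply/measurable_EFinP/measurable_funM; [exact: exprn_measurable|exact: measurable_gauss].
rewrite (_ : (\int[mu]_x _)%E = (\int[mu]_x (x ^+ 2 * gauss x)%:E)%E); last first.
  by apply: eq_integral => x _; rewrite gee0_abs// lee_fin mulr_ge0 ?sqr_ge0 ?gauss_ge0.
rewrite integral_gaussX2; apply: lte_mul_pinfty => //; first by rewrite lee_fin sqr_ge0.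
have := integrable_fin_num measurableT integrable_gauss.
by rewrite fin_numElt => /andP[].
Qed.

Lemma integrable_gaussX : mu.-integrable setT (fun x => (x * gauss x)%:E).
Proof.
have iD := integrableD measurableT integrable_gauss integrable_gaussX2.
apply: le_integrable iD => //.
  by apply/measurable_EFinP/measurable_funM => //; exact: measurable_gauss.
move=> x _; rewrite /= lee_fin.
rewrite normrM (ger0_norm (gauss_ge0 x)) [leRHS]ger0_norm; last first.
  by rewrite addr_ge0 ?gauss_ge0// mulr_ge0 ?gauss_ge0// sqr_ge0.
rewrite -[X in X + _]mul1r -mulrDl ler_wpM2r ?gauss_ge0//.
by rewrite ler_norml; apply/andP; split; nra.
Qed.

(** The positive and the negative part are exchanged by x |-> - x, and have a
finite integral. *)
Lemma integral_gaussX : (\int[mu]_x (x * gauss x)%:E = 0)%E.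
Proof.
have cxg : continuous (fun x : R => - (x * gauss x)).
  by move=> x; apply: cvgN; apply: cvgM; [exact: cvg_id|exact: continuous_gauss].
rewrite integralE.
have -> : (\int[mu]_x (fun x => (x * gauss x)%:E)^\+ x =
    \int[mu]_(x in `[0%R, +oo[) (x * gauss x)%:E)%E.
  rewrite [RHS]integral_mkcond; apply: eq_integral => x _.
  rewrite funeposE patchE; case: ifPn; rewrite ?inE/= ?notin_setE/= in_itv/= andbT.
    by move=> x0; rewrite -EFin_max; congr EFin; apply/max_idPl; rewrite mulr_ge0 ?gauss_ge0.
  move/negP; rewrite -ltNge => x0; rewrite -EFin_max; congr EFin; apply/max_idPr.
  by rewrite mulr_le0_ge0 ?gauss_ge0// ltW.
have -> : (\int[mu]_x (fun x => (x * gauss x)%:E)^\- x =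
    \int[mu]_(x in `[0%R, +oo[) (x * gauss x)%:E)%E.
  transitivity (\int[mu]_(x in `]-oo, (- 0)%R]) (- (x * gauss x))%:E)%E.
    rewrite [RHS]integral_mkcond oppr0; apply: eq_integral => x _.
    rewrite funenegE patchE; case: ifPn; rewrite ?inE/= ?notin_setE/= in_itv/=.
      move=> x0; rewrite -EFin_max; congr EFin; apply/max_idPl.
      by rewrite oppr_ge0 mulr_le0_ge0 ?gauss_ge0.
    move/negP; rewrite -ltNge => x0; rewrite -EFin_max; congr EFin; apply/max_idPr.
    by rewrite oppr_le0 mulr_ge0 ?gauss_ge0// ltW.
  rewrite ge0_integration_by_substitutionNy.
  - by apply: eq_integral => x _ /=; rewrite gauss_even mulNr opprK.
  - exact: continuous_subspaceT.
  - move=> x; rewrite in_itv/= oppr0 => x0.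
    by rewrite oppr_ge0 mulr_le0_ge0 ?gauss_ge0// ltW.
rewrite subee//; apply: integrable_fin_num => //.
by apply: integrableS integrable_gaussX.
Qed.

End gauss_moments.

(** The moments of X are integrals against its law, which has the density
normal_pdf 0 s; this reduces them to those of [normal_fun]. *)
Lemma normal_moments d (T : measurableType d) (R : realType) (P : probability T R)
    (X : {RV P >-> R}) (s : R) : 0 < s ->
  (forall A, measurable A -> P (X @^-1` A) = normal_prob 0 s A) ->
  [/\ P.-integrable setT (fun w => (X w ^+ 2)%:E), P.-integrable setT (fun w => (X w)%:E),
    (\int[P]_w (X w ^+ 2)%:E = (s ^+ 2)%:E)%E & (\int[P]_w (X w)%:E = 0)%E].
Proof.
move=> s0 XN; have s1 : s != 0 by rewrite gt_eqF.
pose p := normal_pdf 0 s.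
have pE x : p x = normal_peak s * normal_fun 0 s x by rewrite /p normal_pdfE.
have mp : measurable_fun setT p := measurable_normal_pdf 0 s.
have p0 : forall x, 0 <= p x := normal_pdf_ge0 0 s.
pose XR : T -> measurableTypeR R := X.
have mX : measurable_fun setT XR by exact: (measurable_funPT X).
pose N := measure_function_pushforward__canonical__measure_function_Measure P mX.
have NE A : measurable A -> N A = (\int[lebesgue_measure]_(x in A) (p x)%:E)%E.
  by move=> mA; rewrite -[RHS]/(normal_prob 0 s A) -XN.
have fE (f : R -> R) x : (f x * p x)%:E = ((normal_peak s)%:E * (f x * normal_fun 0 s x)%:E)%E.
  by rewrite pE -EFinM; congr EFin; ring.
have key (f : R -> R) : measurable_fun setT f ->
    lebesgue_measure.-integrable setT (fun x => (f x * normal_fun 0 s x)%:E) ->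
    P.-integrable setT (fun w => (f (X w))%:E) /\
    (\int[P]_w (f (X w))%:E = (normal_peak s)%:E *
      \int[lebesgue_measure]_x (f x * normal_fun 0 s x)%:E)%E.
  move=> mf ifg; have mfE : measurable_fun setT (EFin \o f) by exact/measurable_EFinP.
  have [|ifN eN] := @integral_density _ _ _ lebesgue_measure N p mp p0 NE f mf.
    by under eq_fun do rewrite fE; apply: integrableZl.
  have iP : P.-integrable setT ((EFin \o f) \o XR).
    have mfX : measurable_fun setT ((EFin \o f) \o XR).
      by apply: measurableT_comp => //; exact: measurableT_comp.
    apply/integrableP; split => //.
    have /integrableP[_] := ifN.
    by rewrite ge0_integral_pushforward//; exact: measurableT_comp.
  split=> //; move: eN; rewrite (integral_pushforward mX mfE)// => ->.
  by under eq_integral do rewrite fE; exact: integralZl.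
have [i2 e2] := key (fun x => x ^+ 2) (exprn_measurable _) (integrable_gaussX2 s0).
have [i1 e1] := key id (@measurable_id _ _ _) (integrable_gaussX s0).
split=> //; last by rewrite e1 integral_gaussX// mule0.
rewrite e2 integral_gaussX2// muleCA -[RHS]mule1; congr (_ * _)%E.
rewrite -(integral_normal_pdf 0 s).
under [RHS]eq_integral do rewrite -/p pE EFinM.
by rewrite integralZl//; exact: integrable_gauss.
Qed.

(** * Square integrable functions *)

(** A substitute for the Cauchy-Schwarz inequality under a limit: the weight e
makes one of the factors negligible, and e^-1 multiplies the factor that tends
to 0. *)
Lemma normrM_le_young (R : realType) (e u v : R) : 0 < e ->
  `|u * v| <= e * u ^+ 2 + e^-1 * v ^+ 2.
Proof.
move=> e0.
rewrite normrM -(real_normK (num_real u)) -(real_normK (num_real v)).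
have p0 := normr_ge0 u; have q0 := normr_ge0 v.
set p := `|u| in p0 *; set q := `|v| in q0 *.
have -> : e * p ^+ 2 + e^-1 * q ^+ 2 = e^-1 * ((e * p) ^+ 2 + q ^+ 2).
  by field; rewrite gt_eqF.
rewrite ler_pdivlMl//.
have := sqr_ge0 (e * p - q); have : 0 <= e * p * q by rewrite mulr_ge0// mulr_ge0// ltW.
nra.
Qed.

Section sq_integrable.
Context d (T : measurableType d) (R : realType) (mu : {measure set T -> \bar R}).

Definition sq_integrable (f : T -> R) :=
  measurable_fun setT f /\ mu.-integrable setT (fun x => (f x ^+ 2)%:E).

Lemma sq_integrableM (f g : T -> R) : sq_integrable f -> sq_integrable g ->
  mu.-integrable setT (fun x => (f x * g x)%:E).
Proof.
move=> [mf f2] [mg g2]; have fg := integrableD measurableT f2 g2.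
apply: le_integrable fg => //; first by apply/measurable_EFinP/measurable_funM.
move=> x _; rewrite /= lee_fin normrM [leRHS]ger0_norm ?addr_ge0 ?sqr_ge0//.
rewrite -[X in _ <= X + _]real_normK ?num_real//.
rewrite -[X in _ <= _ + X]real_normK ?num_real//.
have := sqr_ge0 (`|f x| - `|g x|); have := sqr_ge0 (`|f x| + `|g x|); nra.
Qed.

Lemma sq_integrableD (f g : T -> R) : sq_integrable f -> sq_integrable g ->
  sq_integrable (fun x => f x + g x).
Proof.
move=> sf sg; have [mf f2] := sf; have [mg g2] := sg.
split; first exact: measurable_funD.
have fg := integrableZl measurableT 2 (sq_integrableM sf sg).
have := integrableD measurableT (integrableD measurableT f2 g2) fg.
by apply: eq_integrable => // x _; rewrite /= -EFinM -!EFinD; congr EFin; ring.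
Qed.

Lemma sq_integrableZ (c : R) (f : T -> R) : sq_integrable f ->
  sq_integrable (fun x => c * f x).
Proof.
move=> [mf f2]; split; first exact: measurable_funM.
have := integrableZl measurableT (c ^+ 2) f2.
by apply: eq_integrable => // x _; rewrite /= -EFinM exprMn.
Qed.

Lemma sq_integrable_sum (I : Type) (r : seq I) (f : I -> T -> R) :
  (forall i, sq_integrable (f i)) ->
  sq_integrable (fun x => \sum_(i <- r) f i x).
Proof.
move=> sf; elim: r => [|i r IH].
  have -> : (fun x => \sum_(i <- [::]) f i x) = cst 0.
    by apply/funext => x; rewrite big_nil.
  split; first exact: measurable_cst.
  under eq_fun do rewrite /= expr0n; exact: integrable0.
have -> : (fun x => \sum_(j <- i :: r) f j x) = (fun x => f i x + \sum_(j <- r) f j x).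
  by apply/funext => x; rewrite big_cons.
exact: sq_integrableD.
Qed.

Lemma sq_integrableB (f g : T -> R) : sq_integrable f -> sq_integrable g ->
  sq_integrable (fun x => f x - g x).
Proof.
move=> sf /(sq_integrableZ (-1)) sg; have := sq_integrableD sf sg.
by under eq_fun do rewrite mulN1r.
Qed.

(** The integral is taken in the extended reals, so that convergence to 0
contains the statement that the difference is eventually square integrable. *)
Definition L2_cvg (fn : nat -> T -> R) (f : T -> R) :=
  (\int[mu]_x ((f x - fn n x) ^+ 2)%:E)%E @[n --> \oo] --> 0%E.

Lemma L2_cvg_sq_integrable (fn : nat -> T -> R) (f : T -> R) :
  measurable_fun setT f -> (forall n, sq_integrable (fn n)) -> L2_cvg fn f ->
  sq_integrable f.
Proof.
move=> mf sfn /fine_cvgP[[n _ /(_ n (leqnn n)) fin] _].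
have -> : f = (fun x => fn n x + (f x - fn n x)) by apply/funext => x; ring.
apply: sq_integrableD => //; split; first by apply: measurable_funB => //; case: (sfn n).
apply/integrableP; split.
  by apply/measurable_EFinP/measurable_funX/measurable_funB => //; case: (sfn n).
under eq_integral do rewrite gee0_abs ?lee_fin ?sqr_ge0//.
by move: fin; rewrite fin_numElt => /andP[].
Qed.

Lemma L2_cvg_cst (f : T -> R) : L2_cvg (fun=> f) f.
Proof.
rewrite /L2_cvg; under eq_fun do under eq_integral do rewrite subrr expr0n.
by rewrite integral0; exact: cvg_cst.
Qed.

(** Continuity of the inner product: with a = f - fn and b = g - gn,
f g - fn gn = - a b + a g + f b, where every product has a factor that tends
to 0 in L2. *)
Lemma L2_cvg_mul (fn gn : nat -> T -> R) (f g : T -> R) :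
  (forall n, sq_integrable (fn n)) -> (forall n, sq_integrable (gn n)) ->
  sq_integrable f -> sq_integrable g ->
  L2_cvg fn f -> L2_cvg gn g ->
  \int[mu]_x (fn n x * gn n x) @[n --> \oo] --> \int[mu]_x (f x * g x).
Proof.
move=> sfn sgn sf sg cf cg.
pose A n := \int[mu]_x (f x - fn n x) ^+ 2; pose B n := \int[mu]_x (g x - gn n x) ^+ 2.
have A0 : A n @[n --> \oo] --> 0 by apply: fine_cvg; exact: cf.
have B0 : B n @[n --> \oo] --> 0 by apply: fine_cvg; exact: cg.
pose F := \int[mu]_x f x ^+ 2; pose G := \int[mu]_x g x ^+ 2.
have F0 : 0 <= F by apply: Rintegral_ge0 => x _; rewrite sqr_ge0.
have G0 : 0 <= G by apply: Rintegral_ge0 => x _; rewrite sqr_ge0.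
have bnd n (e : R) : 0 < e ->
    `|\int[mu]_x (f x * g x) - \int[mu]_x (fn n x * gn n x)|
      <= (1 + e^-1) * (A n + B n) + e * (F + G).
  move=> e0.
  have ifg := sq_integrableM sf sg; have ifgn := sq_integrableM (sfn n) (sgn n).
  have [_ iA] := sq_integrableB sf (sfn n); have [_ iB] := sq_integrableB sg (sgn n).
  have [_ iF] := sf; have [_ iG] := sg.
  rewrite -RintegralB//.
  have iAB := integrableZl measurableT (1 + e^-1) (integrableD measurableT iA iB).
  have iFG := integrableZl measurableT e (integrableD measurableT iF iG).
  have -> : (1 + e^-1) * (A n + B n) + e * (F + G) =
     \int[mu]_x ((1 + e^-1) * ((f x - fn n x) ^+ 2 + (g x - gn n x) ^+ 2) +
        e * (f x ^+ 2 + g x ^+ 2)).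
    rewrite RintegralD//; congr (_ + _).
      rewrite RintegralZl//; last exact: (integrableD measurableT iA iB).
      by rewrite RintegralD.
    rewrite RintegralZl//; last exact: (integrableD measurableT iF iG).
    by rewrite RintegralD.
  have ifgB : mu.-integrable setT (EFin \o (fun x => f x * g x - fn n x * gn n x)).
    exact: (integrableB measurableT ifg ifgn).
  apply: (le_trans (le_normr_Rintegral measurableT ifgB)).
  apply: le_Rintegral => //.
  - exact: (integrable_norm ifgB).
  - exact: (integrableD measurableT iAB iFG).
  move=> x _ /=; set a := f x - fn n x; set b := g x - gn n x.
  have -> : f x * g x - fn n x * gn n x = - (a * b) + a * g x + f x * b.
    by rewrite /a /b; ring.
  have amgm u v := normrM_le_young u v e0.
  apply: (le_trans (ler_normD _ _)); apply: (le_trans (lerD (ler_normD _ _) (lexx _))).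
  rewrite normrN.
  have h1 : `|a * b| <= a ^+ 2 + b ^+ 2.
    rewrite normrM -(real_normK (num_real a)) -(real_normK (num_real b)).
    have := sqr_ge0 (`|a| - `|b|); have := sqr_ge0 (`|a| + `|b|); nra.
  have h2 := amgm (g x) a; have h3 := amgm (f x) b.
  by rewrite (mulrC a (g x)); lra.
apply/(@cvgrPdist_le _ R^o) => e e0.
(* e' * (F + G) takes half of e; the other half is left to the terms that tend to 0 *)
pose e' := e / 2 / (F + G + 1).
have FG1 : 0 < F + G + 1 by rewrite ltr_wpDl// addr_ge0.
have e'0 : 0 < e' by rewrite !divr_gt0.
have AB0 : (1 + e'^-1) * (A n + B n) @[n --> \oo] --> (0 : R^o).
  rewrite -[X in _ --> X](mulr0 (1 + e'^-1)) -[X in _ * X](addr0 0).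
  by apply: cvgMr; apply: cvgD.
move/(@cvgrPdist_le _ R^o) : AB0 => /(_ (e / 2)); rewrite divr_gt0// => /(_ isT).
apply: filterS => n; rewrite sub0r normrN => h; apply: (le_trans (bnd n e' e'0)).
have : e' * (F + G) <= e / 2.
  by rewrite /e' -mulrA ler_piMr ?divr_ge0 ?(ltW e0)// mulrC ler_pdivrMr// mul1r lerDl.
have := ler_norm ((1 + e'^-1) * (A n + B n)); lra.
Qed.

End sq_integrable.

(** * Integrals over a probability space *)

Lemma integrable_sumr d (T : measurableType d) (R : realType)
    (mu : {measure set T -> \bar R}) (I : Type) (r : seq I) (f : I -> T -> R) :
  (forall i, mu.-integrable setT (EFin \o f i)) ->
  mu.-integrable setT (EFin \o (fun x => \sum_(i <- r) f i x)).
Proof.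
move=> fi; apply: (eq_integrable measurableT (fun x => \sum_(i <- r) (f i x)%:E)%E).
  by move=> x _; rewrite /= sumEFin.
by apply: integrable_sum => // i _; exact: fi.
Qed.

Lemma Rintegral_sum d (T : measurableType d) (R : realType)
    (mu : {measure set T -> \bar R}) (I : Type) (r : seq I) (f : I -> T -> R) :
  (forall i, mu.-integrable setT (EFin \o f i)) ->
  \int[mu]_x (\sum_(i <- r) f i x) = \sum_(i <- r) \int[mu]_x f i x.
Proof.
move=> fi; elim: r => [|i r IH].
  by under eq_Rintegral do rewrite big_nil; rewrite big_nil /Rintegral integral0.
under eq_Rintegral do rewrite big_cons.
by rewrite RintegralD ?IH ?big_cons//; exact: integrable_sumr.
Qed.

Section probability_integrals.
Context d (T : measurableType d) (R : realType) (P : probability T R).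

Lemma bounded_integrable (X : T -> R) : measurable_fun setT X ->
  (exists M, forall w, `|X w| <= M) -> P.-integrable setT (EFin \o X).
Proof.
move=> mX [M XM]; apply: (@le_integrable _ _ _ P setT measurableT (EFin \o X) (EFin \o cst M)).
- exact/measurable_EFinP.
- by move=> w _; rewrite /= lee_fin (le_trans (XM w))// ler_norm.
- exact: finite_measure_integrable_cst.
Qed.

Lemma normr_Rintegral_le (X : T -> R) (M : R) : measurable_fun setT X ->
  (forall w, `|X w| <= M) -> `|\int[P]_w X w| <= M.
Proof.
move=> mX XM; have iX : P.-integrable setT (EFin \o X).
  by apply: bounded_integrable => //; exists M.
apply: (le_trans (le_normr_Rintegral measurableT iX)).
have -> : M = \int[P]_w (fun=> M) w.
  by rewrite /Rintegral integral_cst// [X in (_ * X)%E]probability_setT mule1.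
apply: le_Rintegral => //; first exact: (integrable_norm iX).
by apply: bounded_integrable => //; exists `|M|.
Qed.

Lemma sq_integrable_cst (a : R) : sq_integrable P (fun=> a).
Proof.
split; first exact: measurable_cst.
by apply: (@bounded_integrable (fun=> a ^+ 2)) => //; exists `|a ^+ 2|.
Qed.

Lemma integral_indicator (A : set T) : measurable A -> \int[P]_w \1_A w = fine (P A).
Proof. by move=> mA; rewrite /Rintegral integral_indic// setIT. Qed.

Lemma integrable_indicator (A : set T) : measurable A -> P.-integrable setT (EFin \o \1_A).
Proof.
move=> mA; apply: bounded_integrable => //.
by exists 1 => w; rewrite indicE; case: (_ \in _); rewrite ?normr1 ?normr0.
Qed.

Lemma indicator_mkset (Q : T -> Prop) (w : T) (c : bool) :
  reflect (Q w) c -> \1_[set w | Q w] w = c%:R :> R.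
Proof.
by move=> Qc; rewrite indicE; congr (_%:R : R); congr nat_of_bool; apply/idP/Qc; rewrite inE.
Qed.

Lemma fine_expectation (X : T -> R) : fine 'E_P[X]%E = \int[P]_w X w.
Proof. by rewrite unlock. Qed.

Lemma fine_variance_centered (X : T -> R) : \int[P]_w X w = 0 ->
  fine 'V_P[X]%E = \int[P]_w (X w * X w).
Proof.
move=> X0; rewrite /variance covariance.unlock fine_expectation.
apply: eq_Rintegral => w _; rewrite -[LHS]/((X w - fine 'E_P[X]%E) * (X w - fine 'E_P[X]%E)).
by rewrite fine_expectation X0 subr0.
Qed.

Lemma ae_eq_Rintegral (X Y : T -> R) : measurable_fun setT X -> measurable_fun setT Y ->
  {ae P, forall w, X w = Y w} -> \int[P]_w X w = \int[P]_w Y w.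
Proof.
move=> mX mY XY; rewrite /Rintegral; congr fine; apply: ae_eq_integral => //.
- exact/measurable_EFinP.
- exact/measurable_EFinP.
- by apply: filterS XY => w XYw _; rewrite XYw.
Qed.

End probability_integrals.

Section independence.
Context d (T : measurableType d) (R : realType) (P : probability T R).

(** The law of (X, Y) agrees with the product of the laws on rectangles, hence
everywhere, and Fubini applies to (x, y) |-> x * y. *)
Lemma independent_integralM (X Y : T -> R) :
  measurable_fun setT X -> measurable_fun setT Y ->
  (forall A B : set R, measurable A -> measurable B ->
     P (X @^-1` A `&` Y @^-1` B) = (P (X @^-1` A) * P (Y @^-1` B))%E) ->
  P.-integrable setT (EFin \o X) -> P.-integrable setT (EFin \o Y) ->
  P.-integrable setT (fun w => (X w * Y w)%:E) /\
  \int[P]_w (X w * Y w) = \int[P]_w X w * \int[P]_w Y w.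
Proof.
move=> mX mY XY iX iY.
pose X' : {RV P >-> R} := mfun_Sub (mem_set mX).
pose Y' : {RV P >-> R} := mfun_Sub (mem_set mY).
pose Z w := (X w, Y w).
have mZ : measurable_fun setT Z by exact: measurable_fun_pair.
pose N := measure_function_pushforward__canonical__measure_function_Measure P mZ.
have NE A : measurable A -> (distribution P X' \x distribution P Y')%E A = N A.
  apply: product_measure_unique => B C mB mC.
  by rewrite /N/= /pushforward -XY.
have mabs : measurable_fun setT (fun y : R => `|y|%:E).
  by apply/measurable_EFinP; apply: measurableT_comp => //; exact: normr_measurable.
pose f (z : R * R) := (z.1 * z.2)%:E.
have mf : measurable_fun setT f by apply/measurable_EFinP/measurable_funM.
have iN : (distribution P X' \x distribution P Y')%E.-integrable setT f.
  apply/integrable12ltyP => //.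
  have -> : (\int[distribution P X']_x \int[distribution P Y']_y `|f (x, y)|)%E =
      (\int[distribution P X']_x (`|x|%:E * \int[distribution P Y']_y `|y|%:E))%E.
    apply: eq_integral => x _.
    rewrite -ge0_integralZl//.
    by apply: eq_integral => y _; rewrite /f/= normrM EFinM.
  rewrite ge0_integralZr//; last exact: integral_ge0.
  rewrite !ge0_integral_distribution//.
  have /integrableP[_ hX] := iX; have /integrableP[_ hY] := iY.
  have X0 : (0 <= \int[P]_x ((fun y : R => `|y|%:E) \o X') x)%E.
    by apply: integral_ge0 => w _; rewrite lee_fin.
  by apply: lte_mul_pinfty => //; rewrite ge0_fin_numE.
have iP : P.-integrable setT (f \o Z).
  have mfZ : measurable_fun setT (f \o Z) by exact: measurableT_comp.
  apply/integrableP; split => //; have /integrableP[_] := iN.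
  rewrite (eq_measure_integral N); last by move=> A mA _; exact: NE.
  by rewrite ge0_integral_pushforward//; exact: measurableT_comp.
split=> //; rewrite /Rintegral.
have -> : (\int[P]_w (X w * Y w)%:E = \int[P]_w (X w)%:E * \int[P]_w (Y w)%:E)%E.
  have -> : (\int[P]_w (X w * Y w)%:E = \int[N]_z f z)%E.
    by rewrite (integral_pushforward mZ mf).
  rewrite -(eq_measure_integral _ (fun A mA _ => NE A mA)).
  rewrite -integral12_prod_meas1//.
  have iD (V : {RV P >-> R}) : P.-integrable setT (EFin \o V) ->
      (distribution P V).-integrable setT (EFin : R -> \bar R).
    move=> /integrableP[_ hV]; apply/integrableP; split => //.
    by rewrite ge0_integral_distribution.
  have eD (V : {RV P >-> R}) : P.-integrable setT (EFin \o V) ->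
      (\int[distribution P V]_x x%:E = \int[P]_w (V w)%:E)%E.
    by move=> iV; rewrite (@integral_distribution _ _ _ _ _ P V EFin).
  have /fineK <- := integrable_fin_num measurableT iY.
  rewrite -(eD X')//.
  transitivity (\int[distribution P X']_x (x%:E * (fine (\int[P]_w (Y w)%:E))%:E))%E.
    apply: eq_integral => x _; rewrite /fubini_F/f/=.
    under eq_integral do rewrite EFinM.
    rewrite integralZl//; last exact: (iD Y').
    by rewrite (eD Y')// fineK// integrable_fin_num.
  by rewrite integralZr//; exact: (iD X').
by rewrite fineM// integrable_fin_num.
Qed.

End independence.

(** * Brownian increments after an adapted past *)

Section sigma_independence.
Context d (T : measurableType d) (R : realType) (P : probability T R).

(** A |-> P (A `&` E) and A |-> P A * P E are finite measures that agree on a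
pi-system. *)
Lemma pi_system_independent (G : set_system T) (E : set T) :
  G `<=` measurable -> G setT -> setI_closed G -> measurable E ->
  (forall A, G A -> P (A `&` E) = (P A * P E)%E) ->
  forall A, <<s G >> A -> P (A `&` E) = (P A * P E)%E.
Proof.
move=> GM GT GI mE GE A sA.
have PEfin : P E \is a fin_num by exact: fin_num_measure.
pose r : {nonneg R} := NngNum (fine_ge0 (measure_ge0 P E)).
transitivity (mrestr P mE A) => //.
transitivity (mscale r P A); last by rewrite /mscale/= fineK// muleC.
apply: (@g_sigma_algebra_measure_unique _ _ _ G GM (fun=> setT)) => //.
- by rewrite bigcup_const.
- move=> B GB.
  by rewrite -[LHS]/(P (B `&` E)) -[RHS]/(r%:num%:E * P B)%E GE//= fineK// muleC.
- by move=> _; rewrite -[ltLHS]/(P (setT `&` E)) setTI ltey_eq PEfin.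
Qed.

Lemma preimage_set_system_measurableP (G : set_system T) (X : T -> R) :
  preimage_set_system setT X measurable `<=` <<s G >> <->
  measurable_fun (setT : set (g_sigma_algebraType G)) X.
Proof.
split=> [H _ B mB|H _ [B mB <-]]; first by apply: H; exists B.
exact: H.
Qed.

Lemma sigma_upto_measurable (G : R -> set_system T) (t : R) :
  (forall u, 0 <= u -> G u `<=` measurable) -> sigma_upto G t `<=` measurable.
Proof.
move=> GM; apply: smallest_sub; first exact: sigma_algebra_measurable.
by move=> A [u /=]; rewrite in_itv/= => /andP[u0 _]; exact: GM.
Qed.

Lemma sigma_upto_sub_all (G : R -> set_system T) (t : R) :
  sigma_upto G t `<=` sigma_all G.
Proof.
apply: sub_sigma_algebra2; apply: bigcup_subset => u /=.
by rewrite !in_itv/= andbT => /andP[].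
Qed.

Lemma sigma_upto_le (G : R -> set_system T) (s t : R) : s <= t ->
  sigma_upto G s `<=` sigma_upto G t.
Proof.
move=> st; apply: sub_sigma_algebra2; apply: bigcup_subset => u /=.
by rewrite !in_itv/= => /andP[-> /le_trans]; exact.
Qed.

Lemma g_sigma_setI (G : set_system T) A B :
  <<s G >> A -> <<s G >> B -> <<s G >> (A `&` B).
Proof.
exact: (@measurableI _ (g_sigma_algebraType G)).
Qed.

Lemma g_sigma_setT (G : set_system T) : <<s G >> setT.
Proof. exact: (@measurableT _ (g_sigma_algebraType G)). Qed.

Variables (U : Type) (B : R -> {RV P >-> R}) (K : R -> T -> U).

Let F (t : R) : set_system T :=
  sigma_upto (fun u => real_info B u `|` discrete_info K u) t.

Hypotheses (mK : forall u, 0 <= u -> discrete_info K u `<=` measurable)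
  (BM : standard_brownian_motion B)
  (BK : independent_systems P (sigma_all (real_info B)) (sigma_all (discrete_info K))).

Lemma real_info_measurable u : real_info B u `<=` measurable.
Proof.
move=> _ [A mA <-]; exact: (measurable_funPT (B u)).
Qed.

Lemma filtration_measurable t : F t `<=` measurable.
Proof.
apply: sigma_upto_measurable => u u0 A [|]; first exact: real_info_measurable.
exact: mK.
Qed.

Lemma increment_sigma_all (s t : R) (A : set R) : 0 <= s -> 0 <= t -> measurable A ->
  sigma_all (real_info B) ((fun w => B t w - B s w) @^-1` A).
Proof.
move=> s0 t0 mA.
have mB u : 0 <= u -> measurable_fun
    (setT : set (g_sigma_algebraType (\bigcup_(u in `[0, +oo[) real_info B u))) (B u).
  move=> u0; apply/preimage_set_system_measurableP => C BC.
  by apply: sub_sigma_algebra; exists u => //=; rewrite in_itv/= u0.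
have := measurable_funB (mB t t0) (mB s s0).
by move=> /(_ measurableT A mA); rewrite setTI.
Qed.

(** The joint past at s is generated by the intersections of a past event A1 of
B and an event A2 of K. For these, independence of B and K detaches A2 from A1
and the increment, which are independent of each other by the definition of
Brownian motion. *)
Lemma increment_independent (s t : R) (A : set T) (E : set R) :
  0 <= s -> s <= t -> F s A -> measurable E ->
  P (A `&` (fun w => B t w - B s w) @^-1` E) =
    (P A * P ((fun w => B t w - B s w)%R @^-1` E))%E.
Proof.
move=> s0 st FA mE; have t0 := le_trans s0 st.
set D := _ @^-1` E.
have mD : measurable D.
  by rewrite -[D]setTI; apply: (measurable_funB (measurable_funPT (B t)) (measurable_funPT (B s))).
pose G : set_system T := [set A | exists A1 A2, [/\ sigma_upto (real_info B) s A1,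
   sigma_upto (discrete_info K) s A2 & A = A1 `&` A2]].
have m1 : sigma_upto (real_info B) s `<=` measurable.
  by apply: sigma_upto_measurable => u _; exact: real_info_measurable.
have m2 : sigma_upto (discrete_info K) s `<=` measurable.
  exact: sigma_upto_measurable.
apply: (@pi_system_independent G) => //.
- by move=> _ [A1 [A2 [/m1 ? /m2 ? ->]]]; exact: measurableI.
- by exists setT, setT; rewrite setTI; split=> //; exact: g_sigma_setT.
- move=> _ _ [A1 [A2 [s1 s2 ->]]] [A3 [A4 [s3 s4 ->]]].
  exists (A1 `&` A3), (A2 `&` A4); split; [exact: g_sigma_setI..|].
  by rewrite setIACA.
- move=> _ [A1 [A2 [s1 s2 ->]]].
  have [_ _ _ /(_ s t s0 st) indep] := BM.
  have dD := increment_sigma_all s0 t0 mE.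
  have a1 := sigma_upto_sub_all s1; have a2 := sigma_upto_sub_all s2.
  rewrite setIAC (BK (g_sigma_setI a1 dD) a2) indep//.
    by rewrite (BK a1 a2) muleAC.
  by exists E => //; rewrite setTI.
- have FG : F s `<=` <<s G >>; last exact: FG.
  apply: smallest_sub; first exact: smallest_sigma_algebra.
  move=> {FA}A [u /= us [BA|KA]]; apply: sub_sigma_algebra.
    exists A, setT; rewrite setIT; split=> //; last exact: g_sigma_setT.
    by apply: sub_sigma_algebra; exists u.
  exists setT, A; rewrite setTI; split=> //; first exact: g_sigma_setT.
  by apply: sub_sigma_algebra; exists u.
Qed.

Lemma increment_measurable (s t : R) :
  measurable_fun setT (fun w => B t w - B s w).
Proof. exact: (measurable_funB (measurable_funPT (B t)) (measurable_funPT (B s))). Qed.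

Lemma increment_moments (s t : R) : 0 <= s -> s <= t ->
  [/\ sq_integrable P (fun w => B t w - B s w),
      P.-integrable setT (fun w => (B t w - B s w)%:E),
      \int[P]_w (B t w - B s w) ^+ 2 = t - s &
      \int[P]_w (B t w - B s w) = 0].
Proof.
move=> s0; rewrite le_eqVlt => /predU1P[<-|st].
  split.
  - under eq_fun do rewrite subrr; split; first exact: measurable_cst.
    by under eq_fun do rewrite expr0n; exact: integrable0.
  - by under eq_fun do rewrite subrr; exact: integrable0.
  - under eq_Rintegral do rewrite subrr expr0n.
    by rewrite /Rintegral integral0 subrr.
  - by under eq_Rintegral do rewrite subrr; rewrite /Rintegral integral0.
have ts : 0 < t - s by rewrite subr_gt0.
have sts : 0 < Num.sqrt (t - s) by rewrite sqrtr_gt0.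
pose D : {RV P >-> R} := mfun_Sub (mem_set (increment_measurable s t)).
have [_ _ BN _] := BM.
have [i2 i1 e2 e1] := @normal_moments _ _ _ P D _ sts (BN s t s0 st).
split=> //; first by split=> //; exact: increment_measurable.
  by rewrite /Rintegral e2/= sqr_sqrtr// ltW.
by rewrite /Rintegral e1.
Qed.

Definition adapted (t : R) (X : T -> R) :=
  preimage_set_system setT X measurable `<=` F t.

Lemma adapted_mfunP (t : R) (X : T -> R) : adapted t X <->
  measurable_fun (setT : set (g_sigma_algebraType
     (\bigcup_(u in `[0, t]) (real_info B u `|` discrete_info K u)))) X.
Proof. exact: preimage_set_system_measurableP. Qed.

Lemma adaptedM (t : R) (X Y : T -> R) : adapted t X -> adapted t Y ->
  adapted t (fun w => X w * Y w).
Proof.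
move=> /adapted_mfunP mX /adapted_mfunP mY; apply/adapted_mfunP.
exact: measurable_funM.
Qed.

Lemma adapted_le (s t : R) (X : T -> R) : s <= t -> adapted s X -> adapted t X.
Proof. by move=> st aX A /aX; exact: sigma_upto_le. Qed.

Lemma adapted_measurable (t : R) (X : T -> R) : adapted t X -> measurable_fun setT X.
Proof.
by move=> aX _ A mA; apply: (@filtration_measurable t); apply: aX; exists A.
Qed.

Lemma adapted_increment (s t : R) : 0 <= s -> s <= t ->
  adapted t (fun w => B t w - B s w).
Proof.
move=> s0 st.
have mB u : 0 <= u -> u <= t -> measurable_fun (setT : set (g_sigma_algebraType
     (\bigcup_(u in `[0, t]) (real_info B u `|` discrete_info K u)))) (B u).
  move=> u0 ut; apply/preimage_set_system_measurableP => C BC.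
  by apply: sub_sigma_algebra; exists u; [rewrite /= in_itv/= u0|left].
apply/adapted_mfunP; apply: measurable_funB; apply: mB => //.
exact: le_trans st.
Qed.

(** The increment is independent of X, is centred and has variance t - s. *)
Lemma adapted_integralM (s t : R) (X : T -> R) : 0 <= s -> s <= t ->
  adapted s X -> P.-integrable setT (EFin \o X) ->
  \int[P]_w (X w * (B t w - B s w)) = 0 /\
  P.-integrable setT (fun w => (X w * (B t w - B s w) ^+ 2)%:E) /\
  \int[P]_w (X w * (B t w - B s w) ^+ 2) = \int[P]_w X w * (t - s).
Proof.
move=> s0 st aX iX; have [[_ i2] i1 e2 e1] := increment_moments s0 st.
have mX := adapted_measurable aX; have mD := increment_measurable s t.
have indep (A E : set R) : measurable A -> measurable E ->
    P (X @^-1` A `&` (fun w => B t w - B s w) @^-1` E) =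
    (P (X @^-1` A) * P ((fun w => B t w - B s w)%R @^-1` E))%E.
  by move=> mA mE; apply: increment_independent => //; apply: aX; exists A; rewrite ?setTI.
split.
  have [_ ->] := independent_integralM mX mD indep iX i1.
  by rewrite e1 mulr0.
have [||iXD ->] := independent_integralM mX _ _ iX i2.
- exact: measurable_funX.
- move=> A E mA mE.
  have mE' : measurable ((fun x : R => x ^+ 2) @^-1` E).
    by rewrite -[X in measurable X]setTI; exact: (@exprn_measurable R setT 2).
  exact: indep mA mE'.
by split=> //; rewrite e2.
Qed.

End sigma_independence.

(** * Integrals of simple processes *)

Section simple_integral.
Context d (T : measurableType d) (R : realType) (P : probability T R).
Variables (U : Type) (B : R -> {RV P >-> R}) (K : R -> T -> U).
Hypotheses (mK : forall u, 0 <= u -> discrete_info K u `<=` measurable)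
  (BM : standard_brownian_motion B)
  (BK : independent_systems P (sigma_all (real_info B)) (sigma_all (discrete_info K))).
Variables (m : nat) (tau : nat -> R).
Hypotheses (tau0 : tau 0 = 0) (tau_le : forall i, (i < m)%N -> tau i <= tau i.+1).

Local Notation D i w := (B (tau i.+1) w - B (tau i) w).
Local Notation adapted := (adapted B K).

Definition adapted_coef (c : nat -> T -> R) := forall i, (i < m)%N ->
  adapted (tau i) (c i) /\ exists M, forall w, `|c i w| <= M.

Lemma grid_le i j : (i <= j)%N -> (j <= m)%N -> tau i <= tau j.
Proof.
elim: j => [|j IH]; first by rewrite leqn0 => /eqP ->.
rewrite leq_eqVlt => /predU1P[->//|ij] jm.
exact: le_trans (IH ij (ltnW jm)) (tau_le jm).
Qed.

Lemma grid_ge0 i : (i <= m)%N -> 0 <= tau i.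
Proof. by move=> im; rewrite -tau0; exact: grid_le. Qed.

Lemma adapted_coefM (c e : nat -> T -> R) : adapted_coef c -> adapted_coef e ->
  adapted_coef (fun i w => c i w * e i w).
Proof.
move=> ac ae i im; have [ci [M cM]] := ac i im; have [ei [M' eM']] := ae i im.
split; first exact: adaptedM.
by exists (M * M') => w; rewrite normrM ler_pM.
Qed.

Lemma adapted_coef_integrable c i : adapted_coef c -> (i < m)%N ->
  P.-integrable setT (EFin \o c i).
Proof.
move=> ac im; have [ci cM] := ac i im.
by apply: bounded_integrable => //; exact: adapted_measurable ci.
Qed.

Lemma sq_integrable_coefD c i : adapted_coef c -> (i < m)%N ->
  sq_integrable P (fun w => c i w * D i w).
Proof.
move=> ac im; have [ci _] := ac i im; have mc := adapted_measurable mK ci.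
split; first by apply: measurable_funM => //; exact: increment_measurable.
have [ai _] := adapted_coefM ac ac im.
have icc := adapted_coef_integrable (adapted_coefM ac ac) im.
have [_ [+ _]] := adapted_integralM mK BM BK (grid_ge0 (ltnW im)) (tau_le im) ai icc.
by apply: eq_integrable => // w _; rewrite /= !expr2 mulrACA.
Qed.

Lemma coefD_diag c e i : adapted_coef c -> adapted_coef e -> (i < m)%N ->
  \int[P]_w (c i w * D i w * (e i w * D i w)) =
  \int[P]_w (c i w * e i w) * (tau i.+1 - tau i).
Proof.
move=> ac ae im.
have [ai _] := adapted_coefM ac ae im.
have ice := adapted_coef_integrable (adapted_coefM ac ae) im.
have [_ [_ <-]] := adapted_integralM mK BM BK (grid_ge0 (ltnW im)) (tau_le im) ai ice.
by apply: eq_Rintegral => w _; rewrite mulrACA expr2.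
Qed.

(** The increment over the later cell is centred and independent of the three
other factors, which belong to its past. *)
Lemma coefD_off_diag c e i j : adapted_coef c -> adapted_coef e -> (i < j)%N -> (j < m)%N ->
  \int[P]_w (c i w * D i w * (e j w * D j w)) = 0.
Proof.
move=> ac ae ij jm; have im := ltn_trans ij jm.
have [ci _] := ac i im; have [ej [M eM]] := ae j jm.
have aX : adapted (tau j) (fun w => c i w * D i w * e j w).
  apply: adaptedM => //; apply: (@adapted_le _ _ _ _ _ _ _ (tau i.+1)).
    exact: grid_le ij (ltnW jm).
  apply: adaptedM; first by apply: adapted_le ci; exact: tau_le.
  by apply: adapted_increment; [exact: grid_ge0 (ltnW im)|exact: tau_le].
have iX : P.-integrable setT (EFin \o (fun w => c i w * D i w * e j w)).
  apply: (sq_integrableM (f := fun w => c i w * D i w)).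
    exact: sq_integrable_coefD.
  split; first exact: adapted_measurable ej.
  exact: (adapted_coef_integrable (adapted_coefM ae ae)).
have [+ _] := adapted_integralM mK BM BK (grid_ge0 (ltnW jm)) (tau_le jm) aX iX.
by move=> <-; apply: eq_Rintegral => w _; rewrite mulrA.
Qed.

(** The polarised form serves twice: e = c gives the second moment of the
integral, and the constant 1 for e its covariance with B t. *)
Lemma simple_isometry c e : adapted_coef c -> adapted_coef e ->
  \int[P]_w ((\sum_(i < m) c i w * D i w) * (\sum_(i < m) e i w * D i w)) =
  \sum_(i < m) \int[P]_w (c i w * e i w) * (tau i.+1 - tau i).
Proof.
move=> ac ae.
under eq_Rintegral do rewrite big_distrlr/=.
have icede i j : P.-integrable setT
    (fun w => (c (i : 'I_m) w * D i w * (e (j : 'I_m) w * D j w))%:E).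
  by apply: sq_integrableM; exact: sq_integrable_coefD.
rewrite Rintegral_sum; last first.
  by move=> i; apply: integrable_sumr => j; exact: icede.
apply: eq_bigr => i _; rewrite Rintegral_sum; last by move=> j; exact: icede.
rewrite (bigD1 i)//= coefD_diag// big1 ?addr0// => j; rewrite neq_ltn => /orP[ji|ij].
  under eq_Rintegral do rewrite mulrC.
  exact: coefD_off_diag.
exact: coefD_off_diag.
Qed.

Lemma simple_integral_mean c : adapted_coef c ->
  \int[P]_w (\sum_(i < m) c i w * D i w) = 0.
Proof.
move=> ac; rewrite Rintegral_sum; last first.
  move=> i; have := sq_integrableM (sq_integrable_coefD ac (ltn_ord i)) (sq_integrable_cst P 1).
  by under eq_fun do rewrite mulr1.
rewrite big1// => i _; have [ci cM] := ac i (ltn_ord i).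
have [+ _] := adapted_integralM mK BM BK (grid_ge0 (ltnW (ltn_ord i))) (tau_le (ltn_ord i))
  ci (adapted_coef_integrable ac (ltn_ord i)).
by [].
Qed.

End simple_integral.

(** * The product of the probability space and time *)

Section right_continuous.
Context d (T : measurableType d) (R : realType).

(** The approximation lies strictly to the right of s, so right continuity of a
process applies along it. *)
Lemma cvg_grid_right (s : R) : 0 <= s ->
  ((Num.truncn (s * n.+1%:R)).+1%:R / n.+1%:R : R) @[n --> \oo] --> s^'+.
Proof.
move=> s0; set r := fun n => _.
have rs n : s < r n.
  rewrite /r ltr_pdivlMr ?ltr0n//.
  by have /truncn_itv/andP[] : 0 <= s * n.+1%:R by rewrite mulr_ge0.
have rle n : r n <= s + harmonic n.
  rewrite /r/= ler_pdivrMr ?ltr0n// mulrDl mulVf ?pnatr_eq0// -natr1 lerD2r.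
  by have /truncn_itv/andP[] : 0 <= s * n.+1%:R by rewrite mulr_ge0.
have cr : r n @[n --> \oo] --> s.
  apply: (@squeeze_cvgr _ _ _ _ (cst s) (fun n => s + harmonic n)).
  - by near=> n; rewrite /cst (ltW (rs n)) rle.
  - exact: cvg_cst.
  - rewrite -[X in _ --> X]addr0; apply: cvgD; [exact: cvg_cst|exact: cvg_harmonic].
move=> A sA; have : \forall n \near \oo, s < r n -> A (r n) := cr _ sA.
by apply: filterS => n /(_ (rs n)).
Unshelve. all: by end_near. Qed.

(** X is the pointwise limit of the processes that are frozen, on each cell of
a grid of times, at the right end of the cell; these are jointly measurable
since they are constant in time on each of countably many cells. *)
Lemma right_continuous_measurable (X : R -> T -> R) :
  (forall s, 0 <= s -> measurable_fun setT (X s)) ->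
  (forall s w, 0 <= s -> X u w @[u --> s^'+] --> X s w) ->
  measurable_fun [set z : T * measurableTypeR R | 0 <= z.2]
    (fun z : T * measurableTypeR R => X z.2 z.1).
Proof.
move=> mX rX.
pose r n (s : R) : R := (Num.truncn (s * n.+1%:R)).+1%:R / n.+1%:R.
apply: (@measurable_fun_cvg _ _ _ _ (fun n z => X (r n z.2) z.1)); last first.
  move=> [w s] /= s0.
  exact: (cvg_comp _ _ (cvg_grid_right s0) (rX s w s0)).
move=> n.
have n0 : 0 < n.+1%:R :> R by rewrite ltr0n.
pose E k : set (T * measurableTypeR R) :=
  setT `*` [set` `[k%:R / n.+1%:R, k.+1%:R / n.+1%:R[].
have -> : [set z : T * measurableTypeR R | 0 <= z.2] = \bigcup_k E k.
  apply/seteqP; split=> [[w s] /= s0|[w s] [k _ [_ /=]]]; rewrite ?in_itv/=.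
    have /truncn_itv/andP[h1 h2] : 0 <= s * n.+1%:R by rewrite mulr_ge0.
    exists (Num.truncn (s * n.+1%:R)) => //; split=> //=.
    by rewrite in_itv/= ler_pdivrMr// ltr_pdivlMr// h1.
  by move=> /andP[ks _]; apply: le_trans ks; rewrite divr_ge0.
have mE k : measurable (E k) by apply: measurableX.
apply/measurable_fun_bigcup => // k.
apply: (eq_measurable_fun (fun z : T * measurableTypeR R => X (k.+1%:R / n.+1%:R) z.1)).
  move=> [w s]; rewrite inE => -[_ /=]; rewrite in_itv/= ler_pdivrMr// ltr_pdivlMr// => /andP[h1 h2].
  rewrite /r; congr (X (_%:R / _) w); congr S; apply/esym.
  by apply: truncn_def; rewrite h1 h2.
apply: measurable_funTS; apply: measurableT_comp => //; apply: mX.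
by rewrite divr_ge0.
Qed.

End right_continuous.

Section product_interval.
Context d (T : measurableType d) (R : realType) (P : probability T R).
Notation leb := (@lebesgue_measure R).
Notation mu := (P \x leb)%E.

Lemma rectangle_integral (X : T -> R) (I : set (measurableTypeR R)) (l : R) :
  measurable I -> leb I = l%:E -> P.-integrable setT (EFin \o X) ->
  mu.-integrable setT (fun z => (X z.1 * \1_I z.2)%:E) /\
  \int[mu]_z (X z.1 * \1_I z.2) = \int[P]_w X w * l.
Proof.
move=> mI lI iX.
have mX : measurable_fun setT X by apply/measurable_EFinP; case/integrableP : iX.
have m1 : measurable_fun setT (\1_I : measurableTypeR R -> R) by exact: measurable_indic.
have mf : measurable_fun setT (fun z : T * measurableTypeR R => (X z.1 * \1_I z.2)%:E).
  by apply/measurable_EFinP/measurable_funM; exact: measurableT_comp.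
have iI : (\int[leb]_x (\1_I x)%:E = l%:E)%E.
  by rewrite integral_indic// setIT; exact: lI.
have i1 : leb.-integrable setT (EFin \o \1_I).
  apply/integrableP; split; first exact/measurable_EFinP.
  under eq_integral do rewrite /= ger0_norm//.
  by rewrite iI ltry.
have inner (x : R) : (\int[leb]_y (x * \1_I y)%:E = (x * l)%:E)%E.
  under eq_integral do rewrite EFinM.
  by rewrite integralZl// iI.
have l0 : 0 <= l by rewrite -lee_fin -lI.
have imf : mu.-integrable setT (fun z => (X z.1 * \1_I z.2)%:E).
  apply/integrable12ltyP => //=.
  under eq_integral do under eq_integral do rewrite normrM [X in (_ * X)%R]ger0_norm//.
  under eq_integral do rewrite inner EFinM.
  rewrite ge0_integralZr//; last by apply/measurable_EFinP/measurableT_comp.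
  by rewrite muleC lte_mul_pinfty//; case/integrableP : iX.
split=> //; rewrite /Rintegral -integral12_prod_meas1// /fubini_F/=.
under eq_integral do rewrite inner EFinM.
by rewrite integralZr// fineM// integrable_fin_num.
Qed.

End product_interval.

Section simple_product.
Context d (T : measurableType d) (R : realType) (P : probability T R).
Variables (U : Type) (B : R -> {RV P >-> R}) (K : R -> T -> U).
Hypotheses (mK : forall u, 0 <= u -> discrete_info K u `<=` measurable)
  (BM : standard_brownian_motion B)
  (BK : independent_systems P (sigma_all (real_info B)) (sigma_all (discrete_info K))).
Notation leb := (@lebesgue_measure R).
Notation mu := (P \x leb)%E.
Let F (t : R) : set_system T :=
  sigma_upto (fun u => real_info B u `|` discrete_info K u) t.
Variables (t : R) (H : @simple_process d T R).
Hypothesis (aH : adapted_simple F t H).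

Local Notation m := (sp_size H).
Local Notation tau := (sp_time H).
Local Notation c := (sp_coef H).

Lemma sp_time_le i : (i < m)%N -> tau i <= tau i.+1.
Proof. by case: aH => _ _ + _; apply. Qed.

Lemma sp_time0 : tau 0 = 0. Proof. by case: aH. Qed.

Lemma sp_timem : tau m = t. Proof. by case: aH. Qed.

Lemma sp_adapted_coef : adapted_coef B K m tau c.
Proof. by case: aH => _ _ _ H4 i im; exact: H4. Qed.

Lemma cst_adapted_coef (a : R) : adapted_coef B K m tau (fun _ _ => a).
Proof.
move=> i im; split; last by exists `|a|.
by apply/adapted_mfunP; exact: measurable_cst.
Qed.

Lemma sp_integral_mean : \int[P]_w sp_integral B H w = 0.
Proof. exact: (simple_integral_mean mK BM BK sp_time0 sp_time_le sp_adapted_coef). Qed.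

Lemma sq_integrable_sp_integral : sq_integrable P (sp_integral B H).
Proof.
apply: sq_integrable_sum => i.
exact: (sq_integrable_coefD mK BM BK sp_time0 sp_time_le sp_adapted_coef).
Qed.

(** A simple process seen as one function on the product space, where its
distance to the integrand is an ordinary L2 distance. *)
Definition sp_prod (z : T * measurableTypeR R) := sp_eval H z.2 z.1.

Lemma lebesgue_measure_step (i : 'I_m) : leb (`]tau i, tau i.+1])%classic = (tau i.+1 - tau i)%:E.
Proof.
rewrite lebesgue_measure_itv/= lte_fin; case: ltP => [_|h]; first by rewrite EFinB.
by rewrite (@le_anti _ _ (tau i) (tau i.+1)) ?subrr// h sp_time_le.
Qed.

Lemma step_integral (X : T -> R) (i : 'I_m) : P.-integrable setT (EFin \o X) ->
  mu.-integrable setT (fun z => (X z.1 * \1_(`]tau i, tau i.+1]) z.2)%:E) /\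
  \int[mu]_z (X z.1 * \1_(`]tau i, tau i.+1]) z.2) =
    \int[P]_w X w * (tau i.+1 - tau i).
Proof. by move=> iX; apply: rectangle_integral => //; exact: lebesgue_measure_step. Qed.

(** The isometry between the process and the constant 1, whose integral
telescopes to B t - B 0. *)
Lemma sp_prod_integral :
  \int[mu]_z sp_prod z = \int[P]_w (sp_integral B H w * (B t w - B 0 w)).
Proof.
have ac i := adapted_coef_integrable mK sp_adapted_coef (ltn_ord i).
rewrite /sp_prod /sp_eval Rintegral_sum; last by move=> i; case: (step_integral i (ac i)).
under eq_bigr do rewrite (step_integral _ (ac _)).2.
transitivity (\sum_(i < m) \int[P]_w (c i w * 1) * (tau i.+1 - tau i)).
  by apply: eq_bigr => i _; under [X in _ = X * _]eq_Rintegral do rewrite mulr1.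
rewrite -(simple_isometry mK BM BK sp_time0 sp_time_le sp_adapted_coef (cst_adapted_coef 1)).
apply: eq_Rintegral => w _; congr (_ * _).
under eq_bigr do rewrite mul1r.
by rewrite -(big_mkord xpredT (fun i => B (tau i.+1) w - B (tau i) w)) telescope_sumr// sp_timem sp_time0.
Qed.

(** The intervals of constancy are disjoint. *)
Lemma sp_prod_sqr (z : T * measurableTypeR R) :
  sp_prod z ^+ 2 = \sum_(i < m) c i z.1 ^+ 2 * \1_(`]tau i, tau i.+1]) z.2.
Proof.
rewrite expr2 /sp_prod /sp_eval big_distrlr/=; apply: eq_bigr => i _.
have disj (j k : 'I_m) : (j < k)%N ->
    \1_(`]tau j, tau j.+1]) z.2 * \1_(`]tau k, tau k.+1]) z.2 = 0 :> R.
  move=> jk; rewrite !indicE.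
  case: (boolP (z.2 \in `]tau j, tau j.+1]%classic)); rewrite ?mul0r// inE/= in_itv/= => /andP[_ h1].
  case: (boolP (z.2 \in `]tau k, tau k.+1]%classic)); rewrite ?mulr0// inE/= in_itv/= => /andP[h2 _].
  have := grid_le sp_time_le jk (ltnW (ltn_ord k)); move=> h3.
  by have := lt_le_trans h2 (le_trans h1 h3); rewrite ltxx.
rewrite (bigD1 i)//= big1 ?addr0 => [|j].
  rewrite mulrACA -expr2; congr (_ * _).
  by rewrite indicE; case: (_ \in _); rewrite ?mulr1 ?mulr0.
rewrite neq_ltn mulrACA => /orP[ji|ij]; last by rewrite disj ?mulr0.
by rewrite [X in _ * X]mulrC disj ?mulr0.
Qed.

Lemma sq_integrable_sp_prod : sq_integrable mu sp_prod.
Proof.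
have ac i := adapted_coef_integrable mK sp_adapted_coef (ltn_ord i).
have ac2 i := adapted_coef_integrable mK (adapted_coefM sp_adapted_coef sp_adapted_coef) (ltn_ord i).
split.
  have : mu.-integrable setT (EFin \o sp_prod).
    by apply: integrable_sumr => i; case: (step_integral i (ac i)).
  by case/integrableP => /measurable_EFinP.
under eq_fun do rewrite sp_prod_sqr.
by apply: integrable_sumr => i; case: (step_integral i (ac2 i)).
Qed.

Lemma sp_prod_isometry :
  \int[mu]_z (sp_prod z * sp_prod z) = \int[P]_w (sp_integral B H w * sp_integral B H w).
Proof.
have ac2 i := adapted_coef_integrable mK (adapted_coefM sp_adapted_coef sp_adapted_coef) (ltn_ord i).
under eq_Rintegral do rewrite -expr2 sp_prod_sqr.
rewrite Rintegral_sum; last by move=> i; case: (step_integral i (ac2 i)).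
under eq_bigr do rewrite (step_integral _ (ac2 _)).2.
by rewrite -(simple_isometry mK BM BK sp_time0 sp_time_le sp_adapted_coef sp_adapted_coef).
Qed.

Lemma sp_prod_support (z : T * measurableTypeR R) : z.2 \notin `[0, t] -> sp_prod z = 0.
Proof.
move=> zt; rewrite /sp_prod /sp_eval big1// => i _; rewrite indicE.
rewrite memNset ?mulr0//= in_itv/= => /andP[h1 h2]; case/negP : zt.
rewrite in_itv/= (le_trans _ (ltW h1)) ?(le_trans h2)//.
  by rewrite -sp_timem; apply: (grid_le sp_time_le) (ltn_ord i) _.
by rewrite (grid_ge0 sp_time0 sp_time_le (ltnW (ltn_ord i))).
Qed.

End simple_product.

(** * Moments of the Ito integral *)

Lemma cvgr_unique (R : realType) (u : nat -> R) (a b : R) :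
  u @ \oo --> a -> u @ \oo --> b -> b = a.
Proof. by move=> ua ub; rewrite -(cvg_lim _ ua)// -(cvg_lim _ ub). Qed.

Lemma cvgr_cst (R : realType) (a : R) : (fun _ : nat => a) @ \oo --> a.
Proof. exact: cvg_cst. Qed.

Section ito_moments.
Context d (T : measurableType d) (R : realType) (P : probability T R).
Variables (U : Type) (B : R -> {RV P >-> R}) (K : R -> T -> U).
Hypotheses (mK : forall u, 0 <= u -> discrete_info K u `<=` measurable)
  (BM : standard_brownian_motion B)
  (BK : independent_systems P (sigma_all (real_info B)) (sigma_all (discrete_info K))).
Notation leb := (@lebesgue_measure R).
Notation mu := (P \x leb)%E.
Variables (X : R -> T -> R) (M : R) (t : R).
Hypotheses (t0 : 0 <= t) (mX : forall s, 0 <= s -> measurable_fun setT (X s))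
  (rX : forall s w, 0 <= s -> X u w @[u --> s^'+] --> X s w)
  (XM : forall s w, `|X s w| <= M).

(** The integrand on the product space, set to 0 outside [0, t] as simple
processes are. *)
Let Xt (z : T * measurableTypeR R) : R := X z.2 z.1 * \1_(`[0, t]) z.2.
Let It (z : T * measurableTypeR R) : R := \1_(`[0, t]) z.2.

Lemma lebesgue_measure_It : leb `[0, t]%classic = t%:E.
Proof.
rewrite lebesgue_measure_itv/= lte_fin; case: ltP => [_|h]; first by rewrite oppr0 addr0.
by rewrite (@le_anti _ _ t 0) ?h.
Qed.

Lemma measurable_restr : measurable_fun setT Xt.
Proof.
pose E : set (T * measurableTypeR R) := setT `*` [set` `[0, t]].
have mE : measurable E by exact: measurableX.
have -> : Xt = ((fun z => X z.2 z.1) \_ E).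
  apply/funext => z; rewrite patchE /Xt indicE.
  have -> : (z \in E) = (z.2 \in `[0, t]%classic).
    by apply/idP/idP; rewrite !inE => -[].
  by case: ifP => _; rewrite ?mulr1 ?mulr0.
apply/(measurable_restrictT _ mE); apply: measurable_funS (right_continuous_measurable mX rX).
  rewrite (_ : mkset _ = setT `*` [set` `[0%R, +oo[]); first exact: measurableX.
  by apply/seteqP; split=> z; rewrite /= in_itv/= andbT => //; case.
by move=> z [_ /=]; rewrite in_itv/= => /andP[].
Qed.

Lemma rectangle_integral_cst (a : R) : mu.-integrable setT (fun z => (a * It z)%:E) /\
  \int[mu]_z (a * It z) = a * t.
Proof.
have ia : P.-integrable setT (EFin \o (fun=> a)).
  by apply: bounded_integrable => //; exists `|a|.
have [? ->] := rectangle_integral (measurable_itv `[0, t]) lebesgue_measure_It ia.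
split=> //; rewrite /Rintegral integral_cst//.
by rewrite [X in (_ * X)%E]probability_setT mule1.
Qed.

Lemma sq_integrable_It : sq_integrable mu It.
Proof.
have [i1 _] := rectangle_integral_cst 1; split.
  by case/integrableP : i1 => /measurable_EFinP + _; under eq_fun do rewrite mul1r.
move: i1; apply: eq_integrable => // z _.
by rewrite mul1r /It indicE; case: (_ \in _); rewrite ?expr1n ?expr0n.
Qed.

Lemma sq_integrable_restr : sq_integrable mu Xt.
Proof.
split; first exact: measurable_restr.
have [iM _] := rectangle_integral_cst (M ^+ 2).
apply: le_integrable iM => //; first by apply/measurable_EFinP/measurable_funX; exact: measurable_restr.
move=> z _; rewrite /= lee_fin /Xt /It exprMn indicE; case: (_ \in _); last first.
  by rewrite expr0n/= !mulr0.
rewrite expr1n !mulr1 !ger0_norm ?sqr_ge0// -real_normK ?num_real//.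
by rewrite lerXn2r ?nnegrE//; exact: le_trans (XM 0 point).
Qed.

Lemma restr_integrable : mu.-integrable setT (EFin \o Xt).
Proof.
have := sq_integrableM sq_integrable_restr sq_integrable_It.
apply: eq_integrable => // z _; rewrite /Xt /It /= -mulrA indicE.
by case: (_ \in _); rewrite ?mulr1 ?mulr0.
Qed.

Lemma fubini_G_restr :
  fubini_G P (EFin \o Xt) = (fun s => (\int[P]_w X s w)%:E) \_ `[0, t].
Proof.
apply/funext => s; rewrite /fubini_G patchE /Xt/= indicE; case: ifPn => [|_].
  rewrite inE/= in_itv/= => /andP[s0 _].
  under eq_integral do rewrite mulr1.
  rewrite fineK// integrable_fin_num//.
  by apply: bounded_integrable; [exact: mX|exists M].
by under eq_integral do rewrite mulr0; rewrite integral0.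
Qed.

Lemma fubini_restr : \int[mu]_z Xt z = \int[leb]_(s in `[0, t]) \int[P]_w X s w.
Proof.
rewrite {1}/Rintegral -(integral21_prod_meas1 restr_integrable) /Rintegral; congr fine.
by rewrite [RHS]integral_mkcond fubini_G_restr.
Qed.

Lemma integrable_mean : leb.-integrable `[0, t] (fun s => (\int[P]_w X s w)%:E).
Proof.
have mI : measurable (`[0, t] : set (measurableTypeR R))%classic by exact: measurable_itv.
have iM : leb.-integrable `[0, t] (EFin \o cst M).
  by apply: integrable_cstr => //; rewrite [X in (X < _)%E]lebesgue_measure_It ltry.
apply: le_integrable iM => //.
  apply/(measurable_restrictT _ mI); rewrite -fubini_G_restr.
  exact: measurable_fubini_G restr_integrable.
move=> s; rewrite /= in_itv/= => /andP[s0 _]; rewrite lee_fin [leRHS]ger0_norm.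
  by apply: normr_Rintegral_le; [exact: mX|].
exact: le_trans (XM 0 point).
Qed.

Variables (Y : {RV P >-> R}).
Hypothesis ito : is_ito_integral P
  (sigma_upto (fun u => real_info B u `|` discrete_info K u)) B X t Y.

(** Each moment is an inner product; it is known for simple processes, and
[L2_cvg_mul] passes to the limit on the probability space and on the product
space. *)
Lemma ito_moments : [/\ sq_integrable P Y, \int[P]_w Y w = 0,
  \int[P]_w (Y w * (B t w - B 0 w)) = \int[leb]_(s in `[0, t]) \int[P]_w X s w &
  \int[P]_w (Y w * Y w) = \int[mu]_z (Xt z * Xt z)].
Proof.
have [Hn [aH cX cY]] := ito.
have sI n := sq_integrable_sp_integral mK BM BK (aH n).
have sS n := sq_integrable_sp_prod mK (aH n).
have sY : sq_integrable P Y.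
  by apply: L2_cvg_sq_integrable cY => //; exact: measurable_funPT.
have cS : L2_cvg mu (fun n => sp_prod (Hn n)) Xt.
  rewrite /L2_cvg; apply: cvg_trans cX; apply: near_eq_cvg; near=> n.
  have mf : measurable_fun setT (fun z => ((Xt z - sp_prod (Hn n) z) ^+ 2)%:E).
    apply/measurable_EFinP/measurable_funX/measurable_funB; first exact: measurable_restr.
    by case: (sS n).
  have f0 z : (0 <= ((Xt z - sp_prod (Hn n) z) ^+ 2)%:E)%E by rewrite lee_fin sqr_ge0.
  rewrite (fubini_tonelli1 _ mf f0).
  apply: eq_integral => w _; rewrite integral_mkcond /fubini_F; apply: eq_integral => s _.
  rewrite patchE /Xt/= indicE; case: ifPn => st; first by rewrite mulr1 -sqrrN opprB.
  rewrite mulr0 (sp_prod_support (aH n))// ?subrr ?expr0n//.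
  by apply: contraNN st => h; rewrite inE.
split=> //.
- have := L2_cvg_mul sI (fun=> sq_integrable_cst P 1) sY (sq_integrable_cst P 1) cY (L2_cvg_cst _ _).
  under eq_fun do under eq_Rintegral do rewrite mulr1.
  under eq_fun do rewrite (sp_integral_mean mK BM BK (aH _)).
  under eq_Rintegral do rewrite mulr1.
  by move=> /(cvgr_unique (@cvgr_cst R 0)).
- have [sB _ _ _] := increment_moments BM (lexx 0) t0.
  have h1 := L2_cvg_mul sI (fun=> sB) sY sB cY (L2_cvg_cst _ _).
  have h2 := L2_cvg_mul sS (fun=> sq_integrable_It) sq_integrable_restr sq_integrable_It cS (L2_cvg_cst _ _).
  rewrite -fubini_restr.
  (* the indicator of [0, t] is the process 1, whose integral is B t - B 0 *)
  have -> : \int[mu]_z Xt z = \int[mu]_z (Xt z * It z).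
    apply: eq_Rintegral => z _; rewrite /Xt /It -mulrA indicE.
    by case: (_ \in _); rewrite ?mulr1 ?mulr0.
  apply: (cvgr_unique h2); move: h1; apply: cvg_trans; apply: near_eq_cvg; near=> n.
  rewrite -(sp_prod_integral mK BM BK (aH n)); apply: eq_Rintegral => z _.
  rewrite /It indicE; case: (boolP (z.2 \in _)); rewrite ?mulr1// => zt.
  rewrite mulr0 (sp_prod_support (aH n))//.
  by apply: contraNN zt => h; rewrite inE.
- have h1 := L2_cvg_mul sI sI sY sY cY cY.
  have h2 := L2_cvg_mul sS sS sq_integrable_restr sq_integrable_restr cS cS.
  apply: (cvgr_unique h2); move: h1; apply: cvg_trans; apply: near_eq_cvg; near=> n.
  by rewrite (sp_prod_isometry mK BM BK (aH n)).
Unshelve. all: by end_near. Qed.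

End ito_moments.

(** * Evolution of the mean sign on each phase *)

Lemma sum_kronecker (R : pzRingType) (n : nat) (c : 'I_n -> R) (i0 : 'I_n) : \sum_i (i0 == i)%:R * c i = c i0.
Proof.
rewrite (bigD1 i0)//= eqxx mul1r big1 ?addr0// => i ii0.
by rewrite eq_sym (negbTE ii0) mul0r.
Qed.

Section MAP_semigroup.
Context d (T : measurableType d) (R : realType) (P : probability T R).
Variables (n : nat) (b : 'rV[R]_n) (C D : 'M[R]_n) (J : R -> T -> 'I_n) (K : R -> T -> nat).
Let JK u w := (J u w, K u w).
Hypothesis mJK : forall u, 0 <= u -> discrete_info JK u `<=` measurable.

Definition jump (s h : R) (m : nat) (j : 'I_n) : set T :=
  [set w | J (s + h) w = j /\ K (s + h) w = (K s w + m)%N].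

Definition mean_sign_phase (s : R) (j : 'I_n) : R :=
  \int[P]_w ((-1) ^+ K s w * \1_[set w | J s w = j] w).

Lemma measurable_JK u (Q : 'I_n -> nat -> Prop) : 0 <= u ->
  measurable [set w | Q (J u w) (K u w)].
Proof.
move=> u0; apply: (mJK u0); exists [set x | Q x.1 x.2] => //.
by rewrite setTI.
Qed.

Lemma measurable_fun_JK u (f : 'I_n -> nat -> R) : 0 <= u ->
  measurable_fun setT (fun w => f (J u w) (K u w)).
Proof. by move=> u0 _ A mA; rewrite setTI; exact: (measurable_JK (fun i k => A (f i k))). Qed.

Lemma measurable_jump s h m j : 0 <= s -> 0 <= h -> measurable (jump s h m j).
Proof.
move=> s0 h0.
have -> : jump s h m j = \bigcup_k ([set w | K s w = k] `&`
    [set w | J (s + h) w = j /\ K (s + h) w = (k + m)%N]).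
  apply/seteqP; split=> [w [jw kw]|w [k _ [/= <- [? ?]]]]; last by split.
  by exists (K s w) => //; split.
apply: bigcupT_measurable => k; apply: measurableI.
  exact: (measurable_JK (fun _ k' => k' = k)).
by apply: (measurable_JK (fun j' k' => j' = j /\ k' = (k + m)%N)); rewrite addr_ge0.
Qed.

Variable p : R -> nat -> 'I_n -> 'I_n -> R.
Hypotheses (pE : forall (s h : R) A i j m, 0 <= s -> 0 <= h ->
    sigma_upto (discrete_info JK) s A ->
    P (A `&` [set w | J s w = i]
         `&` [set w | J (s + h) w = j /\ K (s + h) w = (K s w + m)%N])
    = (P (A `&` [set w | J s w = i]) * (p h m i j)%:E)%E).

(** The Markov property in integral form: given phase i at time s, the
transition over the next h does not depend on an event decided at time s. *)
Lemma past_integral s h (Q : 'I_n -> nat -> Prop) i j m : 0 <= s -> 0 <= h ->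
  \int[P]_w (\1_[set w | Q (J s w) (K s w)] w * \1_[set w | J s w = i] w *
     \1_(jump s h m j) w) =
  \int[P]_w (\1_[set w | Q (J s w) (K s w)] w * \1_[set w | J s w = i] w) * p h m i j.
Proof.
move=> s0 h0; set A := mkset _.
have mi : measurable [set w | J s w = i] by exact: (measurable_JK (fun i' _ => i' = i)).
have mA : measurable A by exact: measurable_JK.
have mj := measurable_jump m j s0 h0.
under eq_Rintegral do rewrite -[_ * _ * _]/((\1_A \* \1__) _ * _) -indicI.
rewrite [in RHS](_ : (fun w => _) = \1_(A `&` [set w | J s w = i])); last first.
  by rewrite indicI.
rewrite [in LHS](_ : (fun w => _) = \1_(A `&` [set w | J s w = i] `&` jump s h m j)); last first.
  by rewrite (indicI _ (A `&` _)).
rewrite !integral_indicator//; [|exact: measurableI|by apply: measurableI => //; exact: measurableI].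
rewrite /jump pE ?fineM ?fin_num_measure//; first exact: measurableI.
by apply: sub_sigma_algebra; exists s; [rewrite /= in_itv/= s0 lexx|exists [set x | Q x.1 x.2]; rewrite ?setTI].
Qed.

Lemma sign_indicator s w : (-1) ^+ K s w =
  \1_[set w | ~~ odd (K s w)] w - \1_[set w | odd (K s w)] w :> R.
Proof.
rewrite -signr_odd !indicE.
have -> : (w \in [set w | ~~ odd (K s w)]) = ~~ odd (K s w) by apply/idP/idP; rewrite inE.
have -> : (w \in [set w | odd (K s w)]) = odd (K s w) by apply/idP/idP; rewrite inE.
by case: (odd _); rewrite /= ?expr0 ?expr1 ?subr0 ?sub0r.
Qed.

(** The sign at time s is a difference of two indicators of events decided at
time s. *)
Lemma sign_past_integral s h i j m : 0 <= s -> 0 <= h ->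
  \int[P]_w ((-1) ^+ K s w * \1_[set w | J s w = i] w * \1_(jump s h m j) w) =
  mean_sign_phase s i * p h m i j.
Proof.
move=> s0 h0; rewrite /mean_sign_phase.
have mi : measurable [set w | J s w = i] by exact: (measurable_JK (fun i' _ => i' = i)).
have mo (c : nat -> bool) : measurable [set w | c (K s w)] by exact: (measurable_JK (fun _ k => c k)).
have mj := measurable_jump m j s0 h0.
have i1 (c : nat -> bool) : P.-integrable setT
    (EFin \o (fun w => \1_[set w | c (K s w)] w * \1_[set w | J s w = i] w)).
  have := integrable_indicator P (measurableI _ _ (mo c) mi).
  by rewrite indicI.
have i2 (c : nat -> bool) : P.-integrable setT
    (EFin \o (fun w => \1_[set w | c (K s w)] w * \1_[set w | J s w = i] w * \1_(jump s h m j) w)).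
  have := integrable_indicator P (measurableI _ _ (measurableI _ _ (mo c) mi) mj).
  by rewrite 2!indicI.
under eq_Rintegral do rewrite sign_indicator !mulrBl.
rewrite RintegralB ?(i2 (fun k => ~~ odd k)) ?(i2 odd)//.
under [in RHS]eq_Rintegral do rewrite sign_indicator mulrBl.
rewrite RintegralB ?(i1 (fun k => ~~ odd k)) ?(i1 odd)// mulrBl.
by rewrite (@past_integral s h (fun _ k => ~~ odd k))// (@past_integral s h (fun _ k => odd k)).
Qed.

Lemma jump_indicator s h m j w : \1_(jump s h m j) w =
  ((J (s + h) w == j) && (K (s + h) w == K s w + m)%N)%:R :> R.
Proof.
apply: indicator_mkset; apply: (iffP andP) => -[/eqP ? /eqP ?]; split=> //; exact/eqP.
Qed.

(** The sign at s + h on the phase j, minus what comes from the transitions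
without arrival, which keep the sign, and with one arrival, which reverse it. *)
Definition sign_remainder (s h : R) (j : 'I_n) (w : T) : R :=
  (-1) ^+ K (s + h) w * \1_[set w | J (s + h) w = j] w -
  \sum_i ((-1) ^+ K s w * \1_[set w | J s w = i] w * \1_(jump s h 0 j) w -
           (-1) ^+ K s w * \1_[set w | J s w = i] w * \1_(jump s h 1 j) w).

(** The indicator that the counter increases by neither 0 nor 1, see
[multi_jumpE]; in this form its mean is read off the transition
probabilities. *)
Definition multi_jump (s h : R) (w : T) : R :=
  1 - \sum_i \sum_j (\1_[set w | J s w = i] w * \1_(jump s h 0 j) w +
                     \1_[set w | J s w = i] w * \1_(jump s h 1 j) w).

Lemma multi_jumpE s h w :
  multi_jump s h w = (~~ ((K (s + h) w == K s w) || (K (s + h) w == (K s w).+1)))%:R.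
Proof.
rewrite /multi_jump.
under eq_bigr do under eq_bigr do
  rewrite -mulrDr (indicator_mkset R (c := J s w == _) eqP) !jump_indicator addn0 addn1.
under eq_bigr do rewrite -mulr_sumr.
rewrite sum_kronecker.
under eq_bigr do rewrite -!mulnb !natrM -mulrDr.
rewrite -mulr_suml.
have -> : \sum_j (J (s + h) w == j)%:R = 1 :> R.
  by under eq_bigr do rewrite -[_%:R]mulr1; rewrite sum_kronecker.
rewrite mul1r; case: eqP => [->|_]; case: eqP => [|_] //=; rewrite ?addr0 ?add0r ?subrr ?subr0//.
by move/eqP; rewrite -addn1 -[X in X == _]addn0 eqn_add2l.
Qed.

Lemma sign_remainder_le s h j w : 0 <= s -> 0 <= h ->
  `|sign_remainder s h j w| <= multi_jump s h w.
Proof.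
move=> s0 h0; rewrite multi_jumpE /sign_remainder.
under eq_bigr do rewrite -mulrBr mulrAC (indicator_mkset R (c := J s w == _) eqP) mulrC.
rewrite sum_kronecker !jump_indicator (indicator_mkset R (c := J (s + h) w == _) eqP) addn0 addn1.
case: (J (s + h) w == j) => /=; last first.
  by rewrite subrr !mulr0 subrr normr0.
case: eqP => [->|_] /=.
  have /negPf -> : K s w != (K s w).+1 by rewrite neq_ltn ltnSn.
  by rewrite subr0 mulr1 subrr normr0.
case: eqP => [->|_] /=.
  by rewrite sub0r mulrN1 mulr1 exprS mulN1r opprK addNr normr0.
by rewrite subrr mulr0 subr0 mulr1 normrX normrN1 expr1n.
Qed.

Lemma multi_jump_integral s h : 0 <= s -> 0 <= h ->
  P.-integrable setT (EFin \o multi_jump s h) /\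
  \int[P]_w multi_jump s h w =
  1 - \sum_i \sum_j fine (P [set w | J s w = i]) * (p h 0 i j + p h 1 i j).
Proof.
move=> s0 h0.
have mi i : measurable [set w | J s w = i] by exact: (measurable_JK (fun i' _ => i' = i)).
have i1 i m j : P.-integrable setT
    (EFin \o (fun w => \1_[set w | J s w = i] w * \1_(jump s h m j) w)).
  have := integrable_indicator P (measurableI _ _ (mi i) (measurable_jump m j s0 h0)).
  by rewrite indicI.
have e1 i m j : \int[P]_w (\1_[set w | J s w = i] w * \1_(jump s h m j) w) =
    fine (P [set w | J s w = i]) * p h m i j.
  have := @past_integral s h (fun _ _ => True) i j m s0 h0.
  have -> : [set w : T | True] = setT by apply/seteqP; split.
  rewrite indicT; under eq_Rintegral do rewrite mul1r.
  move=> ->; congr (_ * _); under eq_Rintegral do rewrite mul1r.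
  exact: integral_indicator.
have i2 i j : P.-integrable setT
    (EFin \o (fun w => \1_[set w | J s w = i] w * \1_(jump s h 0 j) w +
                      \1_[set w | J s w = i] w * \1_(jump s h 1 j) w)).
  exact: (integrableD _ (i1 i 0%N j) (i1 i 1%N j)).
have i3 i := integrable_sumr (index_enum _) (i2 i).
have i4 := integrable_sumr (index_enum _) i3.
have icst : P.-integrable setT (EFin \o (fun=> 1)).
  by apply: bounded_integrable => //; exists 1 => w; rewrite normr1.
split; first exact: (integrableB _ icst i4).
rewrite RintegralB//.
congr (_ - _); first by rewrite /Rintegral integral_cst// [X in (_ * X)%E]probability_setT mule1.
rewrite Rintegral_sum//; apply: eq_bigr => i _.
rewrite Rintegral_sum//; apply: eq_bigr => j _.
by rewrite RintegralD// !e1 mulrDr.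
Qed.

Lemma sign_remainder_integral s h j : 0 <= s -> 0 <= h ->
  P.-integrable setT (EFin \o sign_remainder s h j) /\
  \int[P]_w sign_remainder s h j w = mean_sign_phase (s + h) j -
  \sum_i mean_sign_phase s i * (p h 0 i j - p h 1 i j).
Proof.
move=> s0 h0.
have mi u i : 0 <= u -> measurable [set w | J u w = i].
  by move=> u0; exact: (measurable_JK (fun i' _ => i' = i)).
have sgn_int u (A : set T) : 0 <= u -> measurable A ->
    P.-integrable setT (EFin \o (fun w => (-1) ^+ K u w * \1_A w)).
  move=> u0 mA; apply: bounded_integrable.
    by apply: measurable_funM => //; exact: (measurable_fun_JK (fun _ k => (-1) ^+ k)).
  exists 1 => w; rewrite normrM normrX normrN1 expr1n mul1r indicE.
  by case: (_ \in _); rewrite ?normr1 ?normr0.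
have i1 i m : P.-integrable setT (EFin \o (fun w =>
    (-1) ^+ K s w * \1_[set w | J s w = i] w * \1_(jump s h m j) w)).
  have := sgn_int s _ s0 (measurableI _ _ (mi s i s0) (measurable_jump m j s0 h0)).
  by rewrite indicI; apply: eq_integrable => // w _ /=; rewrite mulrA.
have i2 i : P.-integrable setT (EFin \o (fun w =>
    (-1) ^+ K s w * \1_[set w | J s w = i] w * \1_(jump s h 0 j) w -
    (-1) ^+ K s w * \1_[set w | J s w = i] w * \1_(jump s h 1 j) w)).
  exact: (integrableB _ (i1 i 0%N) (i1 i 1%N)).
have sh0 : 0 <= s + h by rewrite addr_ge0.
have i3 := integrable_sumr (index_enum _) i2.
have i4 := sgn_int _ _ sh0 (mi _ j sh0).
split; first exact: (integrableB _ i4 i3).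
rewrite RintegralB//.
congr (_ - _); rewrite Rintegral_sum//; apply: eq_bigr => i _.
by rewrite RintegralB// !sign_past_integral// mulrBr.
Qed.

Hypotheses (rates : MAP_rates C D p) (CD0 : forall i, \sum_j (C + D) i j = 0).

(** One threshold serves all pairs of phases, as these are finitely many. *)
Lemma rates_unif (e : R) : 0 < e -> exists2 dl : R, 0 < dl & forall h, 0 < h -> h < dl ->
  forall i j, `|p h 0 i j - (i == j)%:R - h * C i j| <= e * h /\
              `|p h 1 i j - h * D i j| <= e * h.
Proof.
move=> e0.
have : \forall h \near 0^'+, forall ij : 'I_n * 'I_n,
    `|C ij.1 ij.2 - (p h 0 ij.1 ij.2 - (ij.1 == ij.2)%:R) / h| <= e /\
    `|D ij.1 ij.2 - p h 1 ij.1 ij.2 / h| <= e.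
  apply: filter_forall => -[i j]; have [hC hD] := rates i j.
  move/(@cvgrPdist_le _ R^o) : hC => /(_ _ e0) hC.
  move/(@cvgrPdist_le _ R^o) : hD => /(_ _ e0) hD.
  by apply: filterS2 hC hD => h.
move=> /nbhs_ballP[dl /= dl0 H]; exists dl => // h h0 hdl i j.
have key (a c : R) : `|a - c / h| <= e -> `|c - h * a| <= e * h.
  move=> ace; rewrite -[X in _ <= _ * X](gtr0_norm h0).
  rewrite (_ : c - h * a = - ((a - c / h) * h)); last by field; rewrite gt_eqF.
  by rewrite normrN normrM ler_wpM2r.
have [|h1 h2] := H h _ h0 (i, j).
  by rewrite /ball/= sub0r normrN gtr0_norm.
by split; apply: key.
Qed.

Lemma mean_sign_phase_norm s j : 0 <= s -> `|mean_sign_phase s j| <= 1.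
Proof.
move=> s0; apply: normr_Rintegral_le.
  apply: measurable_funM; first exact: (measurable_fun_JK (fun _ k => (-1) ^+ k)).
  by apply: measurable_indic; exact: (measurable_JK (fun i' _ => i' = j)).
move=> w; rewrite normrM normrX normrN1 expr1n mul1r indicE.
by case: (_ \in _); rewrite ?normr1 ?normr0.
Qed.

Lemma sum_prob_phase s : 0 <= s -> \sum_i fine (P [set w | J s w = i]) = 1.
Proof.
move=> s0.
have mi i : measurable [set w | J s w = i] by exact: (measurable_JK (fun i' _ => i' = i)).
under eq_bigr do rewrite -integral_indicator//.
rewrite -Rintegral_sum; last by move=> i; exact: integrable_indicator.
transitivity (\int[P]_w (fun=> 1) w).
  apply: eq_Rintegral => w _.
  under eq_bigr do rewrite (indicator_mkset R (c := J s w == _) eqP) -[_%:R]mulr1.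
  by rewrite sum_kronecker.
by rewrite /Rintegral integral_cst// [X in (_ * X)%E]probability_setT mule1.
Qed.

(** The transitions with zero and one arrival contribute v (I + h (C - D)) up
to o(h). The rest is at most the probability of several arrivals, and this is
o(h) as well: the rates of C and D with their zero row sums leave a probability
1 + o(h) to zero and one arrival. The o(h) come from the transition
probabilities only, hence are uniform in s. *)
Lemma mean_sign_phase_rderive (t : R) (j : 'I_n) :
  unif_rderive t (fun s => mean_sign_phase s j)
    (fun s => \sum_i mean_sign_phase s i * (C - D) i j).
Proof.
move=> e e0; pose c : R := \sum_(i < n) (\sum_(j < n) 2 + 2).
have c0 : 0 <= c by apply: sumr_ge0 => i _; rewrite addr_ge0// sumr_ge0.
have [|dl dl0 H] := @rates_unif (e / (c + 1)); first by rewrite divr_gt0// ltr_wpDl.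
set e' := e / (c + 1) in H.
exists dl => // s h s0 h0 hdl _.
pose v := mean_sign_phase s; pose q i := fine (P [set w | J s w = i]).
(* the errors of the linear approximations of the transition probabilities *)
pose al i j := p h 0 i j - (i == j)%:R - h * C i j.
pose be i j := p h 1 i j - h * D i j.
have q0 i : 0 <= q i by rewrite fine_ge0.
have q1 i : q i <= 1.
  by rewrite -(sum_prob_phase s0) (bigD1 i)//= lerDl sumr_ge0// => k _; rewrite fine_ge0.
have h0' := ltW h0.
have [iZ eZ] := sign_remainder_integral j s0 h0'.
have [iW eW] := multi_jump_integral s0 h0'.
have bnd i k : `|al i k| <= e' * h /\ `|be i k| <= e' * h := H h h0 hdl i k.
have ZW : `|\int[P]_w sign_remainder s h j w| <= \int[P]_w multi_jump s h w.
  apply: (le_trans (le_normr_Rintegral measurableT iZ)).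
  apply: le_Rintegral => //; first exact: (integrable_norm iZ).
  by move=> w _; exact: sign_remainder_le.
have WE : \int[P]_w multi_jump s h w = - \sum_i q i * \sum_k (al i k + be i k).
  rewrite eW -[in RHS]sumrN -[X in X - _](sum_prob_phase s0) -sumrB; apply: eq_bigr => i _.
  rewrite -mulr_sumr -[X in X - _]mulr1 -mulrBr -mulrN; congr (_ * _).
  have -> : \sum_k (p h 0 i k + p h 1 i k) = \sum_k (al i k + be i k) +
      (\sum_k (i == k)%:R + h * \sum_k (C + D) i k).
    rewrite mulr_sumr -!big_split/=; apply: eq_bigr => k _.
    by rewrite /al /be mxE; ring.
  rewrite CD0 mulr0 addr0.
  have -> : \sum_k (i == k)%:R = 1 :> R.
    by under eq_bigr do rewrite -[_%:R]mulr1; rewrite sum_kronecker.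
  by ring.
have WB : \int[P]_w multi_jump s h w <= \sum_(i < n) \sum_(k < n) 2 * (e' * h).
  rewrite WE -sumrN; apply: ler_sum => i _; rewrite -mulrN -sumrN.
  apply: (le_trans (ler_norm _)); rewrite normrM (ger0_norm (q0 i)).
  apply: (@le_trans _ _ (1 * \sum_(k < n) 2 * (e' * h))); last by rewrite mul1r.
  apply: ler_pM => //; apply: (le_trans (ler_norm_sum _ _ _)); apply: ler_sum => k _.
  rewrite normrN; have [b1 b2] := bnd i k.
  by apply: (le_trans (ler_normD _ _)); lra.
have -> : mean_sign_phase (s + h) j - mean_sign_phase s j -
    h * (\sum_i mean_sign_phase s i * (C - D) i j) =
    \int[P]_w sign_remainder s h j w + \sum_i v i * (al i j - be i j).
  have -> : \sum_i v i * (al i j - be i j) = \sum_i v i * (p h 0 i j - p h 1 i j) -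
      \sum_i (j == i)%:R * v i - h * \sum_i v i * (C - D) i j.
    rewrite mulr_sumr -!sumrN -!big_split/=; apply: eq_bigr => i _.
    by rewrite !mxE /al /be (eq_sym j); ring.
  by rewrite eZ sum_kronecker /v; ring.
apply: (le_trans (ler_normD _ _)).
have h2 : `|\sum_i v i * (al i j - be i j)| <= \sum_(i < n) 2 * (e' * h).
  apply: (le_trans (ler_norm_sum _ _ _)); apply: ler_sum => i _.
  rewrite normrM -[leRHS]mul1r; apply: ler_pM => //.
    exact: mean_sign_phase_norm.
  by have [b1 b2] := bnd i j; apply: (le_trans (ler_normB _ _)); lra.
apply: (le_trans (lerD (le_trans ZW WB) h2)).
rewrite -big_split/=.
have -> : \sum_(i < n) (\sum_(k < n) 2 * (e' * h) + 2 * (e' * h)) = c * (e' * h).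
  by rewrite [RHS]mulr_suml; apply: eq_bigr => i _; rewrite [RHS]mulrDl mulr_suml.
rewrite mulrA ler_wpM2r// /e' mulrCA ler_piMr ?(ltW e0)//.
by rewrite ler_pdivrMr ?ltr_wpDl// mul1r lerDl.
Qed.

Lemma sum_mean_sign_phase s : 0 <= s ->
  \sum_j mean_sign_phase s j = \int[P]_w (-1) ^+ K s w.
Proof.
move=> s0; rewrite -Rintegral_sum; last first.
  move=> j; apply: bounded_integrable.
    apply: measurable_funM; first exact: (measurable_fun_JK (fun _ k => (-1) ^+ k)).
    by apply: measurable_indic; exact: (measurable_JK (fun i' _ => i' = j)).
  exists 1 => w; rewrite normrM normrX normrN1 expr1n mul1r indicE.
  by case: (_ \in _); rewrite ?normr1 ?normr0.
apply: eq_Rintegral => w _.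
under eq_bigr do rewrite (indicator_mkset R (c := J s w == _) eqP) mulrC.
by rewrite sum_kronecker.
Qed.

Hypotheses (K0 : forall w, K 0 w = 0%N) (J0 : forall i, P [set w | J 0 w = i] = (b 0 i)%:E).

Lemma mean_sign_phase0 j : mean_sign_phase 0 j = b 0 j.
Proof.
rewrite /mean_sign_phase; under eq_Rintegral do rewrite K0 expr0 mul1r.
rewrite integral_indicator ?J0//.
exact: (measurable_JK (fun i' _ => i' = j)).
Qed.

End MAP_semigroup.

(** * The correlation coefficient *)

Section mean_sign_integral.
Context d (T : measurableType d) (R : realType) (P : probability T R).
Variables (n : nat) (b : 'rV[R]_n) (C D : 'M[R]_n) (J : R -> T -> 'I_n) (K : R -> T -> nat).
Hypothesis MAP : MAP_with_phase P b C D J K.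

(** Both sides are sums of the same series: the Taylor series at 0 of the
integral, and the exponential series of the generator between the two vectors. *)
Lemma mean_sign_integral (t : R) : 0 <= t ->
  lebesgue_measure.-integrable `[0, t] (fun s => (\int[P]_w (-1) ^+ K s w)%:E) ->
  \int[lebesgue_measure]_(s in `[0, t]) \int[P]_w (-1) ^+ K s w =
    ((row_mx (row_mx b 0) 0 : 'rV[R]_(n + n + 1)) *m
     mexp (t *: block_mx (block_mx C D D C)
                         (col_mx (const_mx 1) (const_mx (-1)))
                         0 0 : 'M[R]_(n + n + 1)) *m
     (col_mx (col_mx 0 0) 1 : 'cV[R]_(n + n + 1))) 0 0.
Proof.
move=> t0 im; apply/esym/mexp_sandwich.
have [[_ _ _ CD0] mJK [K0 _ _ _ _] J0 [p [_ rates pE]]] := MAP.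
pose v := mean_sign_phase P J K.
pose Q := C - D.
pose e : 'cV[R]_n := const_mx 1.
(* f k is the derivative of order k of the mean sign f 0 *)
pose f k s := \sum_j (Q ^+ k *m e) j 0 * v s j.
have fE s : 0 <= s -> f 0%N s = \int[P]_w (-1) ^+ K s w.
  move=> s0; rewrite -(sum_mean_sign_phase P mJK s0); apply: eq_bigr => j _.
  by rewrite expr0 mul1mx mxE mul1r.
have vd j : unif_rderive t (fun s => v s j) (fun s => \sum_i v s i * Q i j).
  exact: (mean_sign_phase_rderive mJK pE rates CD0).
have fd k : unif_rderive t (f k) (f k.+1).
  have fSE s : f k.+1 s = \sum_j (Q ^+ k *m e) j 0 * (\sum_i v s i * Q i j).
    under eq_bigr do rewrite mulr_sumr.
    rewrite exchange_big/=; apply: eq_bigr => i _.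
    rewrite exprS -mulmxA mxE mulr_suml; apply: eq_bigr => j _; ring.
  rewrite (_ : f k.+1 = fun s => \sum_j (Q ^+ k *m e) j 0 * (\sum_i v s i * Q i j)).
    by apply: unif_rderive_sum => j; exact: unif_rderiveZ.
  exact/funext.
pose a := 1 + \sum_i \sum_j `|Q i j|.
have a1 : 1 <= a by rewrite lerDl sumr_ge0// => i _; rewrite sumr_ge0.
have a0 : 0 <= a := le_trans ler01 a1.
pose L : R := \sum_(j < n) \sum_(l < n) 1.
have L0 : 0 <= L by apply: sumr_ge0 => j _; apply: sumr_ge0.
have fL k s : 0 <= s -> `|f k s| <= L * a ^+ k.
  move=> s0; apply: (le_trans (ler_norm_sum _ _ _)); rewrite mulr_suml; apply: ler_sum => j _.
  rewrite normrM -[leRHS]mulr1; apply: ler_pM => //; last exact: mean_sign_phase_norm.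
  rewrite mxE; apply: (le_trans (ler_norm_sum _ _ _)); rewrite mulr_suml; apply: ler_sum => l _.
  by rewrite [e _ _]mxE mulr1 mul1r normr_mx_exp_le.
pose y u := \int[lebesgue_measure]_(s in `[0, u]) f 0%N s.
have eqf u : \int[lebesgue_measure]_(s in `[0, u]) \int[P]_w (-1) ^+ K s w = y u.
  by apply: eq_Rintegral => s; rewrite inE/= in_itv/= => /andP[s0 _]; rewrite fE.
have if0 : lebesgue_measure.-integrable `[0, t] (EFin \o f 0%N).
  apply: eq_integrable im => // s; rewrite inE/= in_itv/= => /andP[s0 _].
  by rewrite fE.
have yd : unif_rderive t y (f 0%N).
  apply: (integral_unif_rderive (fd 0%N) _ if0) => s s0 _; exact: fL.
(* y followed by its successive derivatives *)
pose F k := if k is k'.+1 then f k' else y.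
have y0 : y 0 = 0 by rewrite /y set_itv1 Rintegral_set1.
have FL k s : 0 <= s -> s <= t -> `|F k s| <= (L * (1 + t)) * a ^+ k.
  have LL : L <= L * (1 + t) by rewrite ler_peMr// lerDl.
  move=> s0 st; case: k => [|k] /=; last first.
    apply: (le_trans (fL k s s0)); apply: ler_pM => //; first by rewrite exprn_ge0.
    by rewrite exprS ler_peMl// exprn_ge0.
  have yt : unif_rderive s y (f 0%N) := unif_rderiveS st yd.
  have key : `|y s| <= L * s.
    have LF x h : 0 <= x -> 0 < h -> x + h <= s -> h * f 0%N x <= L * (x + h) - L * x.
      move=> x0 h0 _; have := fL 0%N x x0; rewrite expr0 mulr1 => /(le_trans (ler_norm _)) h1.
      by have := ler_wpM2l (ltW h0) h1; lra.
    have NLF x h : 0 <= x -> 0 < h -> x + h <= s -> h * (-1 * f 0%N x) <= L * (x + h) - L * x.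
      move=> x0 h0 _; have := fL 0%N x x0; rewrite expr0 mulr1 -normrN => /(le_trans (ler_norm _)) h1.
      by have := ler_wpM2l (ltW h0) h1; lra.
    have := unif_rderive_le s0 yt LF; have := unif_rderive_le s0 (unif_rderiveZ (-1) yt) NLF.
    by rewrite y0 ler_norml => *; apply/andP; split; lra.
  rewrite expr0 mulr1; apply: (le_trans key); rewrite ler_wpM2l//; lra.
rewrite eqf; have Fd k : unif_rderive t (F k) (F k.+1) by case: k => [|k]; [exact: yd|exact: fd].
have := taylor_series_cvg t0 Fd FL.
rewrite [X in series X](_ : _ = (fun k =>
  ((row_mx (row_mx b 0) 0 : 'rV[R]_(n + n + 1)) *m
     (t *: block_mx (block_mx C D D C)
                         (col_mx (const_mx 1) (const_mx (-1)))
                         0 0 : 'M[R]_(n + n + 1)) ^+ k *m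
     (col_mx (col_mx 0 0) 1 : 'cV[R]_(n + n + 1))) 0 0 / k`!%:R))//.
apply/funext => k; rewrite map_generator_expE.
case: k => [|k]; first by rewrite /F y0 !mul0r.
rewrite mulrA [F _ _ * _]mulrC; congr (_ * _ / _).
rewrite /F /f -mulmxA mxE; apply: eq_bigr => j _.
by rewrite /v (mean_sign_phase0 mJK K0 J0) mulrC.
Qed.

End mean_sign_integral.

Theorem theorem4p4 (d : measure_display) (T : measurableType d) (R : realType)
    (P : probability T R) (n : nat) (b : 'rV[R]_n) (C D : 'M[R]_n)
    (K : R -> T -> nat) (B Bstar : R -> {RV P >-> R}) :
  MAP_alternating_BM b C D K B Bstar ->
  forall t : R, 0 < t ->
  Corr B Bstar t =
    t^-1 *
    ((row_mx (row_mx b 0) 0 : 'rV[R]_(n + n + 1)) *m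
     mexp (t *: block_mx (block_mx C D D C)
                         (col_mx (const_mx 1) (const_mx (-1)))
                         0 0 : 'M[R]_(n + n + 1)) *m
     (col_mx (col_mx 0 0) 1 : 'cV[R]_(n + n + 1))) 0 0.
Proof.
move=> [[J MAP] BM BK ito] t t_gt0; have t0 := ltW t_gt0.
have [_ mJK [_ _ JKr _ _] _ _] := MAP.
have mK u : 0 <= u -> discrete_info K u `<=` measurable.
  move=> u0 _ [A _ <-]; rewrite setTI.
  exact: (measurable_JK mJK (fun _ k => A k)).
pose X s w : R := (-1) ^+ K s w.
have mX s : 0 <= s -> measurable_fun setT (X s).
  by move=> s0; exact: (measurable_fun_JK mJK (fun _ k => (-1) ^+ k)).
have rX s w : 0 <= s -> X u w @[u --> s^'+] --> X s w.
  move=> s0; apply: cvg_near_cst; apply: filterS (JKr s w s0) => u [_ Ksu].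
  by rewrite /X Ksu.
have X1 s w : `|X s w| <= 1 by rewrite /X normrX normrN1 expr1n.
have [sY EY EBY EYY] := ito_moments mK BM BK t0 mX rX X1 (ito t t0).
have [B0 _ _ _] := BM.
have [[mD iD2] iD ED2 ED] := increment_moments BM (lexx 0) t0; rewrite subr0 in ED2.
(* B 0 vanishes only almost surely *)
have BD : {ae P, forall w, B t w = B t w - B 0 w}.
  by apply: filterS B0 => w ->; rewrite subr0.
have mB : measurable_fun setT (B t) by exact: measurable_funPT.
have mY : measurable_fun setT (Bstar t) by exact: measurable_funPT.
have EB : \int[P]_w B t w = 0 by rewrite (ae_eq_Rintegral mB mD BD).
have VB : fine 'V_P[B t]%E = t.
  rewrite fine_variance_centered// -[RHS]ED2.
  under [RHS]eq_Rintegral do rewrite expr2.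
  apply: ae_eq_Rintegral; [exact: measurable_funM|exact: measurable_funM|].
  by apply: filterS BD => w BDw; rewrite -BDw.
have VY : fine 'V_P[Bstar t]%E = t.
  rewrite fine_variance_centered// EYY.
  (* the square of the sign is 1 *)
  have [_] := rectangle_integral_cst P t0 1; rewrite mul1r => E; rewrite -[RHS]E.
  apply: eq_Rintegral => z _; rewrite /X mul1r mulrACA -expr2 -exprM mulnC exprM sqrrN expr1n.
  by rewrite expr1n mul1r indicE; case: (_ \in _); rewrite ?mulr1 ?mulr0.
rewrite /Corr !fine_expectation EB mul0r subr0 VB VY.
rewrite -expr2 sqr_sqrtr// mulrC; congr (_ * _).
rewrite -(mean_sign_integral MAP t0) -?EBY.
  apply: ae_eq_Rintegral; [exact: measurable_funM|exact: measurable_funM|].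
  by apply: filterS BD => w BDw; rewrite -BDw mulrC.
exact: (integrable_mean P t0 mX rX X1).
Qed.
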